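(* Let $n\ge 1$, let $S\subset[n]^2$ be admissible, let $\bar A\in\mathscr{M}_S$ with $\|\bar A\|_{\max}\le 1$, let $\sigma>0$, and let $A\sim N_S(\bar A,\sigma^2\mathrm{Id})$. Then, for every real number $t>2|S|$, $$\mathrm{Prob}\{\boldsymbol{c}^{\dagger}(A)>t\}\;\le\;\left(\frac{1+\sigma}{\sigma}\right)\left(\frac{4n^2|S|^2}{t-2|S|}\right)\sqrt{\frac{2}{\pi}},$$ and, for all $\beta>1$, $$\mathbb{E}\big(\log_\beta \boldsymbol{c}^{\dagger}(A)\big)\;\le\;\log_\beta\left(\frac{1+\sigma}{\sigma}\right)+2\log_\beta(n|S|)+\frac{2.65}{\ln\beta}.$$
   Context: Notation: $[n]=\{1,\dots,n\}$; $\mathscr{M}$ is the set of $n\times n$ real matrices and $\Sigma\subset\mathscr{M}$ its subset of singular matrices; for $S\subseteq[n]^2$, $\mathscr{M}_S=\{A\in\mathscr{M}: a_{ij}=0 \text{ whenever } (i,j)\notin S\}$. The set $S$ is admissible if $\mathscr{M}_S$ contains some invertible matrix. $\|A\|_{\max}=\max_{i,j}|a_{ij}|$. Random sparse matrices: $A\sim N_S(\bar A,\sigma^2\mathrm{Id})$ means that the entries $a_{ij}$ with $(i,j)\in S$ are independent Gaussian random variables $a_{ij}\sim N(\bar a_{ij},\sigma^2)$, and $a_{ij}=0$ for $(i,j)\notin S$. Such $A$ is nonsingular with probability one when $S$ is admissible. Componentwise condition number: For $u,v\in\mathbb{R}^p$ let $\frac{u}{v}=(w_1,\dots,w_p)$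 with $w_i=u_i/v_i$ if $v_i\ne 0$, $w_i=0$ if $u_i=v_i=0$, and $w_i=\infty$ otherwise. Put $d(u,v)=\left\|\frac{u-v}{v}\right\|_\infty\in[0,\infty]$; when finite, $d(u,v)=\min\{\nu\ge 0: |u_i-v_i|\le\nu|v_i| \text{ for all } i\}$. For $\delta>0$ let $\mathcal{S}(a,\delta)=\{x\in\mathbb{R}^p: d(x,a)\le\delta\}$. For a continuous map $F:\mathcal{D}\to\mathbb{R}^q$, $\mathcal{D}\subseteq\mathbb{R}^p$, and $a\in\mathcal{D}$, the componentwise condition number of $F$ at $a$ is $$\boldsymbol{c}^F(a)=\lim_{\delta\to 0}\ \sup_{x\in\mathcal{S}(a,\delta)\cap\mathcal{D},\ x\ne a}\frac{d(F(x),F(a))}{d(x,a)}\in[0,\infty].$$ Matrix inversion: for $k,l\in[n]$, $\boldsymbol{c}^{\dagger}_{kl}(A)$ is the componentwise condition number at $A$ of the function $F_{kl}(A)=(A^{-1})_{kl}$ defined on $\mathscr{M}_S\setminus\Sigma$, and $\boldsymbol{c}^{\dagger}(A)=\max_{k,l\in[n]}\boldsymbol{c}^{\dagger}_{kl}(A)$. (All matrices at finite distance $d$ from a matrix in $\mathscr{M}_S$ belong to $\mathscr{M}_S$.) *)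

(* Defs.v *)
From HB Require Import structures.
From mathcomp Require Import all_boot all_order all_algebra.
From mathcomp Require Import all_classical all_reals all_analysis.

Set Implicit Arguments.
Unset Strict Implicit.
Unset Printing Implicit Defensive.

Import Order.TTheory GRing.Theory Num.Theory.
Import numFieldNormedType.Exports.

Local Open Scope classical_set_scope.
Local Open Scope ring_scope.

(* Points of R^p are represented by matrices of any shape (m, n) with m * n = p:
   all notions below only depend on the family of entries. *)

Definition cratio (R : realType) (u v : R) : \bar R :=
  if v != 0 then (u / v)%:E else if u == 0 then 0%E else +oo%E.

Definition cdist (R : realType) (m n : nat) (u v : 'M[R]_(m, n)) : \bar R :=
  \big[maxe/0%E]_(i < m) \big[maxe/0%E]_(j < n)
    `|cratio (u i j - v i j) (v i j)|%E.

Definition cball (R : realType) (m n : nat) (a : 'M[R]_(m, n)) (delta : R) :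
    set 'M[R]_(m, n) :=
  [set x | (cdist x a <= delta%:E)%E].

(* F is a total function of which only the values on D (and at a, which is
   meant to belong to D) are used.  The quotient is never degenerate, since
   0 < cdist x a <= delta.  The value 0 is adjoined because the supremum is
   taken in [0, +oo], so that the supremum of the empty set is 0. *)
Definition ccond (R : realType) (m n p q : nat) (D : set 'M[R]_(m, n))
    (F : 'M[R]_(m, n) -> 'M[R]_(p, q)) (a : 'M[R]_(m, n)) : \bar R :=
  lim (ereal_sup (0%E |`
         [set (cdist (F x) (F a) / cdist x a)%E | x in
           cball a delta `&` D `&` [set x | x <> a]])
       @[delta --> 0^'+]).

Definition supported_mx (R : realType) (n : nat) (S : {set 'I_n * 'I_n}) :
    set 'M[R]_n :=
  [set A | forall i j, (i, j) \notin S -> A i j = 0].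

Definition singular_mx (R : realType) (n : nat) : set 'M[R]_n :=
  [set A | A \notin unitmx].

Definition admissible (R : realType) (n : nat) (S : {set 'I_n * 'I_n}) : Prop :=
  exists A : 'M[R]_n, supported_mx S A /\ A \in unitmx.

Definition inv_dom (R : realType) (n : nat) (S : {set 'I_n * 'I_n}) :
    set 'M[R]_n :=
  @supported_mx R n S `\` @singular_mx R n.

(* The scalar (A^-1)_kl is seen as a point of R^1. *)
Definition cinv_kl (R : realType) (n : nat) (S : {set 'I_n * 'I_n})
    (k l : 'I_n) (A : 'M[R]_n) : \bar R :=
  ccond (@inv_dom R n S) (fun B => (invmx B k l)%:M : 'M[R]_1) A.

(* Outside of the domain of matrix inversion the condition number is +oo; for
   the random matrices considered here this only matters on a null set. *)
Definition cinv (R : realType) (n : nat) (S : {set 'I_n * 'I_n})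
    (A : 'M[R]_n) : \bar R :=
  if A \in @inv_dom R n S then
    \big[maxe/0%E]_(k < n) \big[maxe/0%E]_(l < n) cinv_kl S k l A
  else +oo%E.

Definition loge (R : realType) (beta : R) (x : \bar R) : \bar R :=
  (lne x * (ln beta)^-1%:E)%E.

Definition log (R : realType) (beta x : R) : R := ln x / ln beta.

Definition independent_RVs (d : measure_display) (T : measurableType d)
    (R : realType) (P : probability T R) (I : finType) (J : {set I})
    (X : I -> {RV P >-> R}) : Prop :=
  forall (K : {set I}) (B : I -> set R), K \subset J ->
    (forall i, i \in K -> measurable (B i)) ->
    P [set w | forall i, i \in K -> B i (X i w)] =
    (\prod_(i in K) P (X i @^-1` B i))%E.

Definition rmatrix (d : measure_display) (T : measurableType d)
    (R : realType) (P : probability T R) (n : nat)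
    (A : 'I_n -> 'I_n -> {RV P >-> R}) (w : T) : 'M[R]_n :=
  \matrix_(i, j) A i j w.

(* normal_prob takes the standard deviation as its second parameter; entries
   outside S vanish almost surely, since A ~ N_S only constrains the law. *)
Definition gaussian_on (d : measure_display) (T : measurableType d)
    (R : realType) (P : probability T R) (n : nat) (S : {set 'I_n * 'I_n})
    (Abar : 'M[R]_n) (sigma : R) (A : 'I_n -> 'I_n -> {RV P >-> R}) : Prop :=
  [/\ independent_RVs S (fun ij => A ij.1 ij.2),
      forall i j, (i, j) \in S -> forall B : set R, measurable B ->
        distribution P (A i j) B = normal_prob (Abar i j) sigma B
    & forall i j, (i, j) \notin S -> {ae P, forall w, A i j w = 0}].

(* Main.v *)
Require Import Defs.
From HB Require Import structures.
From mathcomp Require Import all_boot all_order all_algebra.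
From mathcomp Require Import all_classical all_reals all_analysis.
From mathcomp Require Import measurable_realfun ring lra.

Set Implicit Arguments.
Unset Strict Implicit.
Unset Printing Implicit Defensive.

Import Order.TTheory GRing.Theory Num.Theory.
Import numFieldNormedType.Exports.

Local Open Scope classical_set_scope.
Local Open Scope ring_scope.

(** The condition number [cinv S a] is the largest of the numbers [cinv_kl],
    and the proof bounds each of them by ratios involving one random entry at a
    time.

    With b the inverse of a, the identity  x^-1 - a^-1 = - x^-1 (x - a) a^-1
    gives [cinv_kl] in closed form: it is
      sum_ij |b_ki a_ij b_jl| / |b_kl|
    when b_kl is nonzero ([cinv_kl_nonzero]).  When b_kl = 0 it is 0 or +oo,
    according to whether the corresponding cofactor vanishes on all matrices
    with the zero pattern of a ([cinv_kl_vanishing], [cinv_kl_zero]).  The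
    closed form makes the condition number a Borel function of the entries
    ([measurable_cinv]).  Since b_kl is a cofactor divided by the determinant,
    the closed form is at most
      sum_ij |a_ij D_ij det| / |det a| + sum_ij |a_ij D_ij cof| / |cof a|,
    where D_ij is the slope in the entry a_ij ([cinv_value_le]).  Hence
    [cinv S a] > t forces one of these ratios, for some (i, j) in S, to exceed
    s = t / (2 |S|) ([cinv_gt]).

    The determinant and the cofactors are affine in every single entry, so a
    ratio exceeds s exactly when |x M| > s |x M + N|, where x is the entry a_ij
    and M, N depend on the other entries only.  Conditioning on the other
    entries ([prob_section_le]) reduces the question to a Gaussian variable x
    and constants M, N.  There the event lies in an interval whose length is
    2 / (s - 1) times a lower bound of |x| on the event, and |x| times the
    Gaussian density is bounded by (1 + sigma) / (sigma sqrt(2 pi)) uniformly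
    in x; the probability is therefore at most
      (1 + sigma) / sigma * sqrt(2 / pi) / (s - 1)
    ([normal_prob_affine_ratio_le]).  A union bound over at most 2 n^2 |S|
    events gives the tail estimate ([cinv_tail_le]).  It needs the
    determinant, and each cofactor that is not identically zero on the pattern
    S, to be nonzero almost surely; replacing the entries of a matrix where
    the function is nonzero by random ones, one after the other, shows this
    ([randomized_neq0]).

    The second claim integrates the tail of ln cinv, bounding probabilities by
    1 up to ln (6 kappa) with kappa = (1 + sigma) / sigma * n^2 |S|^2
    ([expectation_lne_le]).  The result is ln kappa + ln 6 + sqrt(2 / pi), and
    ln 6 + sqrt(2 / pi) < 2.65. *)

(** * Determinant and cofactors as functions of one entry *)

Section entry_affine.
Variables (R : realType) (n : nat).
Implicit Types (g : 'M[R]_n -> R) (A : 'M[R]_n) (i j k l : 'I_n) (v : R).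

Definition entry_slope g i j A : R := g (A + delta_mx i j) - g A.

Definition entry_affine g : Prop := forall A i j v,
  g (A + v *: delta_mx i j) = g A + v * entry_slope g i j A.

Lemma entry_slope_shift g A i j v : entry_affine g ->
  entry_slope g i j (A + v *: delta_mx i j) = entry_slope g i j A.
Proof.
move=> ag; have := ag A i j (v + 1); rewrite scalerDl scale1r addrA => E.
by rewrite [LHS]/entry_slope E ag; ring.
Qed.

Lemma cofactor_shift_row A i j v l :
  cofactor (A + v *: delta_mx i j) i l = cofactor A i l.
Proof.
congr (_ * \det _); apply/matrixP => r c; rewrite !mxE.
by rewrite (eq_sym _ i) (negbTE (neq_lift _ _)) mulr0 addr0.
Qed.

Lemma det_shift A i j v :
  \det (A + v *: delta_mx i j) = \det A + v * cofactor A i j.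
Proof.
rewrite (expand_det_row _ i) (expand_det_row A i).
under eq_bigr do rewrite cofactor_shift_row !mxE eqxx /= mulrDl.
rewrite big_split /=; congr (_ + _); rewrite (bigD1 j) //= eqxx mulr1.
by rewrite big1 ?addr0// => k /negbTE ->; rewrite mulr0 mul0r.
Qed.

Lemma det_slope A i j : entry_slope determinant i j A = cofactor A i j.
Proof.
by rewrite /entry_slope -[delta_mx i j]scale1r det_shift mul1r addrC addKr.
Qed.

Lemma det_entry_affine : entry_affine determinant.
Proof. by move=> A i j v; rewrite det_slope det_shift. Qed.

(** A cofactor is the determinant of the matrix in which row l is replaced by a
    unit vector, so it inherits affinity from the determinant. *)
Lemma cofactor_entry_affine l k : entry_affine (fun A => cofactor A l k).
Proof.
pose h A : 'M[R]_n := \matrix_(i, j) if i == l then (j == k)%:R else A i j.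
have hE A : cofactor A l k = \det (h A).
  rewrite (expand_det_row (h A) l) (bigD1 k) //= mxE !eqxx mul1r big1 ?addr0.
    by congr (_ * \det _); apply/matrixP => r c; rewrite !mxE eq_sym
      (negbTE (neq_lift _ _)).
  by move=> j /negbTE jk; rewrite mxE eqxx jk mul0r.
have hS A i j v : h (A + v *: delta_mx i j) =
    if i == l then h A else h A + v *: delta_mx i j.
  apply/matrixP => r c; case: ifPn => [/eqP -> | il].
    by rewrite !mxE; case: eqP => [//|_]; rewrite /= mulr0 addr0.
  rewrite !mxE; case: (eqVneq r l) => [->|//].
  by rewrite (eq_sym l) (negbTE il) /= mulr0 addr0.
move=> A i j v; rewrite /entry_slope -[X in _ * (cofactor (A + X) l k - _)]scale1r.
rewrite !hE !hS; case: ifP => _; first by rewrite subrr mulr0 addr0.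
by rewrite !det_shift mul1r; ring.
Qed.

(** A Jacobi-type identity for complementary minors.  It compares the adjugate
    of A with that of x = A + E_ij through
    adj x (x - A) adj A = det x adj A - det A adj x. *)
Lemma cofactor_jacobi A i j k l :
  cofactor A i k * cofactor A l j =
  cofactor A i j * cofactor A l k
  - \det A * entry_slope (fun B => cofactor B l k) i j A.
Proof.
pose x := A + 1 *: delta_mx i j.
have xE : x = A + delta_mx i j by rewrite /x scale1r.
have : \adj x *m (x - A) *m \adj A = \det x *: \adj A - \det A *: \adj x.
  rewrite mulmxBr mul_adj_mx mulmxBl -scalemx1 -scalemxAl mul1mx.
  by rewrite -mulmxA mul_mx_adj mul_mx_scalar.
have -> : x - A = delta_mx i j by rewrite xE addrC addKr.
move/matrixP => /(_ k l); rewrite [X in _ = X]mxE [X in _ + X]mxE.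
rewrite -!/(\adj _) !mxE.
rewrite (bigD1 j) //= !mxE (bigD1 i) //= !mxE !eqxx mulr1.
rewrite big1 ?addr0; last first.
  by move=> r /negbTE ri; rewrite !mxE ri mulr0.
rewrite big1 ?addr0; last first.
  move=> c /negbTE cj; rewrite !mxE big1 ?mul0r// => r _.
  by rewrite !mxE cj andbF mulr0.
rewrite /x det_shift (cofactor_shift_row A i j 1 k) scale1r => ->.
by rewrite /entry_slope; ring.
Qed.

End entry_affine.

(** * Matrix inversion near an invertible matrix *)

Lemma unitmx_neq0 (R : realType) (n : nat) (a : 'M[R]_n) (k : 'I_n) :
  a \in unitmx -> exists i j, a i j != 0.
Proof.
move=> ua; apply: contrapT => h; have /matrixP/(_ k k) := mulmxV ua.
rewrite !mxE eqxx big1; first by move/esym/eqP; rewrite oner_eq0.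
move=> j _; have [->|akj] := eqVneq (a k j) 0; first by rewrite mul0r.
by exfalso; apply: h; exists k, j.
Qed.

Section local_analysis.
Variables (R : realType) (n : nat).
Implicit Types (a x y : 'M[R]_n) (i j k l : 'I_n).

(** Along a line the cofactor is a polynomial; vanishing near 0 it has
    infinitely many roots. *)
Lemma cofactor_line_eq0 a y l k (e : R) : 0 < e ->
  (forall u, 0 < u < e -> cofactor (a + u *: y) l k = 0) ->
  forall u, cofactor (a + u *: y) l k = 0.
Proof.
move=> e0 h.
pose M : 'M[{poly R}]_n := map_mx polyC a + 'X *: map_mx polyC y.
pose p := cofactor M l k.
have pE u : cofactor (a + u *: y) l k = p.[u].
  rewrite -[RHS]/(horner_eval u p) -cofactor_map_mx; congr cofactor.
  by apply/matrixP => i j; rewrite /M !mxE /= /horner_eval !hornerE.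
suff p0 : p = 0 by move=> u; rewrite pE p0 horner0.
apply/eqP; apply: contraT => pn0.
pose s := [seq e / m.+2%:R | m <- iota 0 (size p)].
have := @max_poly_roots _ p s pn0; rewrite size_map size_iota ltnn; apply.
  apply/allP => _ /mapP [m _ ->]; rewrite /root -pE h//.
  by rewrite divr_gt0//= ltr_pdivrMr// ltr_pMr// ltr1n.
rewrite map_inj_uniq ?iota_uniq// => m1 m2 /(mulfI (lt0r_neq0 e0)) /invr_inj.
by move=> /eqP; rewrite eqr_nat => /eqP [].
Qed.

Lemma cvg_det (T : Type) (F : set_system T) (FF : Filter F) (m : nat)
    (f : T -> 'M[R]_m) (b : 'M[R]_m) :
  (forall i j : 'I_m, f x i j @[x --> F] --> b i j) ->
  \det (f x) @[x --> F] --> \det b.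
Proof.
move=> fb; rewrite /determinant; apply: cvg_big => [|s _].
  exact: add_continuous.
apply: cvgM; first exact: cvg_cst.
by apply: cvg_big => [|i _]; [exact: mul_continuous|exact: fb].
Qed.

Lemma invmx_entryE a k l : a \in unitmx ->
  invmx a k l = cofactor a l k / \det a.
Proof. by move=> ua; rewrite /invmx ua !mxE mulrC. Qed.

Lemma invmx_near a (e : R) : a \in unitmx -> 0 < e ->
  exists2 r : R, 0 < r & forall x, (forall i j, `|x i j - a i j| <= r) ->
    x \in unitmx /\ forall i j, `|invmx x i j - invmx a i j| <= e.
Proof.
move=> ua e0.
have cdet : \det x @[x --> nbhs a] --> \det a.
  by apply: cvg_det => i j; exact: coord_continuous.
have ccof l k : cofactor x l k @[x --> nbhs a] --> cofactor a l k.
  apply: cvgM; first exact: cvg_cst.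
  by apply: cvg_det => i j; rewrite !mxE;
    under eq_fun do rewrite !mxE; exact: coord_continuous.
have deta : \det a != 0 by move: ua; rewrite unitmxE unitfE.
have cinv k l : cofactor x l k / \det x @[x --> nbhs a] --> invmx a k l.
  by rewrite invmx_entryE//; apply: cvgM => //; exact: cvgV.
have : \forall x \near nbhs a, x \in unitmx /\
    forall i j, `|invmx x i j - invmx a i j| <= e.
  have nu : \forall x \near nbhs a, x \in unitmx.
    apply: (@filterS _ (nbhs a) _ _ _ _ (cvgr_neq0 _ cdet deta)) => x.
    by rewrite unitmxE unitfE.
  have ni : \forall x \near nbhs a, forall ij : 'I_n * 'I_n,
      `|invmx a ij.1 ij.2 - cofactor x ij.2 ij.1 / \det x| <= e.
    apply: filter_forall => ij.
    by have /cvgrPdist_le /(_ _ e0) := cinv ij.1 ij.2.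
  apply: filterS2 nu ni => x ux xe; split=> // i j.
  by rewrite (invmx_entryE _ _ ux) distrC; exact: (xe (i, j)).
move=> /nbhs_ballP [r /= r0 rP]; exists (r / 2); first by rewrite divr_gt0.
move=> x xa; apply: rP; rewrite mx_norm_ball /ball_ /=.
rewrite (@le_lt_trans _ _ (r / 2))//; last by rewrite ltr_pdivrMr// ltr_pMr// ltr1n.
rewrite [leLHS]mx_normrE; apply/bigmax_leP; split => [|[i j] _ /=].
  by rewrite divr_ge0// ltW.
by rewrite !mxE distrC.
Qed.

(** The resolvent identity.  It is exact, so the first-order behaviour of the
    inverse needs only its continuity. *)
Lemma invmx_diff a x k l : a \in unitmx -> x \in unitmx ->
  invmx x k l - invmx a k l =
  - \sum_i \sum_j invmx x k i * (x i j - a i j) * invmx a j l.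
Proof.
move=> ua ux.
have : invmx x - invmx a = - (invmx x *m (x - a) *m invmx a).
  by rewrite mulmxBr mulVmx// mulmxBl mul1mx -mulmxA mulmxV// mulmx1 opprB.
move/matrixP/(_ k l); rewrite [LHS]mxE [X in _ + X]mxE => ->.
rewrite mxE; congr (- _); rewrite mxE.
under eq_bigr do rewrite mxE big_distrl/=.
rewrite exchange_big/=; apply: eq_bigr => i _; apply: eq_bigr => j _.
by rewrite !mxE.
Qed.

End local_analysis.

(** * The condition number of matrix inversion in closed form *)

Section condition_number.
Variables (R : realType).

Lemma cratio_le (u v delta : R) : 0 <= delta ->
  (`|cratio (u - v) v| <= delta%:E)%E = (`|u - v| <= delta * `|v|).
Proof.
move=> d0; rewrite /cratio; case: (eqVneq v 0) => [->|v0] /=.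
  rewrite normr0 mulr0 subr0 normr_le0.
  by case: (eqVneq u 0) => [_|_] /=; rewrite ?normr0 ?lee_fin.
by rewrite lee_fin normrM normfV ler_pdivrMr// normr_gt0.
Qed.

Lemma cdist_le (m n : nat) (u v : 'M[R]_(m, n)) (delta : R) : 0 <= delta ->
  (cdist u v <= delta%:E)%E <->
  forall i j, `|u i j - v i j| <= delta * `|v i j|.
Proof.
move=> d0; split => [|h].
  move=> /bigmax_leP [_ h] i j; move: (h i isT) => /bigmax_leP [_ /(_ j isT)].
  by rewrite cratio_le.
apply/bigmax_leP; split => [|i _]; first by rewrite lee_fin.
by apply/bigmax_leP; split => [|j _]; rewrite ?lee_fin// cratio_le.
Qed.

Lemma cdist_ge0 (m n : nat) (u v : 'M[R]_(m, n)) : (0 <= cdist u v)%E.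
Proof. exact: bigmax_ge_id. Qed.

Lemma cdist_gt0 (m n : nat) (u v : 'M[R]_(m, n)) : u <> v -> (0 < cdist u v)%E.
Proof.
move=> uv; rewrite lt_neqAle cdist_ge0 andbT eq_sym; apply: contra_notN uv => /eqP d0.
have : (cdist u v <= 0%:E)%E by rewrite d0.
move/(cdist_le _ _ (lexx 0)) => h; apply/matrixP => i j.
by have := h i j; rewrite mul0r normr_le0 subr_eq0 => /eqP.
Qed.

Lemma cdist_scalar (u v : R) :
  cdist (u%:M : 'M[R]_1) (v%:M : 'M[R]_1) = `|cratio (u - v) v|%E.
Proof.
rewrite /cdist !big_ord_recl !big_ord0 !mxE eqxx !mulr1n.
by rewrite !(max_l (abse_ge0 _)).
Qed.

Variable n : nat.
Implicit Types (S : {set 'I_n * 'I_n}) (a x y : 'M[R]_n) (i j k l : 'I_n).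

Lemma cball_supported S a x delta : supported_mx S a -> cball a delta x ->
  0 <= delta -> supported_mx S x.
Proof.
move=> Sa /= ax d0 i j ij.
by move: ax => /(cdist_le _ _ d0) /(_ i j); rewrite Sa// normr0 mulr0 subr0
  normr_le0 => /eqP.
Qed.

Definition mx_support a : {set 'I_n * 'I_n} := [set ij | a ij.1 ij.2 != 0].

Lemma supported_mx_support a : supported_mx (mx_support a) a.
Proof. by move=> i j; rewrite inE negbK => /eqP. Qed.

Lemma mx_support_sub S a : supported_mx S a -> mx_support a \subset S.
Proof.
move=> Sa; apply/fintype.subsetP => -[i j]; rewrite inE /= => aij.
by apply: contraNT aij => /Sa ->.
Qed.

Lemma supported_mxS S S' a : S' \subset S ->
  supported_mx S' a -> supported_mx S a.
Proof. by move=> /fintype.subsetP sS Sa i j ij; apply: Sa; apply: contra ij => /sS. Qed.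

Definition cofactor_vanishes S l k : Prop :=
  forall y, supported_mx S y -> cofactor y l k = 0.

Definition quotients (S : {set 'I_n * 'I_n}) k l a delta : set \bar R :=
  [set (cdist ((invmx x k l)%:M : 'M[R]_1) ((invmx a k l)%:M : 'M[R]_1) / cdist x a)%E
    | x in cball a delta `&` @inv_dom R n S `&` [set x | x <> a]].

Lemma cinv_kl_cvg S k l a (c : \bar R) :
  ereal_sup (0%E |` quotients S k l a delta) @[delta --> 0^'+] --> c ->
  cinv_kl S k l a = c.
Proof. by move=> h; apply: cvg_lim h; exact: ereal_hausdorff. Qed.

(** A point at finite componentwise distance from a has support inside that of
    a, so the entry (k, l) of its inverse is 0 as well. *)
Lemma cinv_kl_vanishing S k l a : inv_dom S a ->
  cofactor_vanishes (mx_support a) l k -> cinv_kl S k l a = 0%E.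
Proof.
move=> [Sa /negP/negPn ua] van; apply: cinv_kl_cvg.
apply: cvg_near_cst; near=> delta.
have d0 : 0 <= delta by near: delta; exact: nbhs_right_ge.
apply/eqP; rewrite eq_le ereal_sup_ubound/= ?andbT; last by left.
apply: ge_ereal_sup => _ [->//|[x [[ax [_ /negP/negPn ux]] _] <-]].
rewrite !invmx_entryE// (van a); last exact: supported_mx_support.
rewrite (van x); last exact: (cball_supported (@supported_mx_support a) ax).
by rewrite !mul0r cdist_scalar subrr /cratio eqxx /= normr0 mul0e.
Unshelve. all: by end_near. Qed.

Lemma normr_entry_le a i j : `|a i j| <= mx_norm a.
Proof.
have := mx_normrE a; rewrite /Num.norm/= => ->.
exact: (le_bigmax _ (fun ij => `|a ij.1 ij.2|) (i, j)).
Qed.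

Lemma cball_entry_le a x delta r : 0 <= delta ->
  delta * (1 + mx_norm a) <= r -> cball a delta x ->
  forall i j, `|x i j - a i j| <= r.
Proof.
move=> d0 dr /(cdist_le _ _ d0) h i j; rewrite (le_trans (h i j))//.
rewrite (le_trans _ dr)// ler_wpM2l//.
by rewrite (le_trans (normr_entry_le a i j))// ler_wpDl.
Qed.

(** The cofactor is nonzero at some matrix y supported like a.  On the segment
    from a to y it has nonzero values arbitrarily close to a, and the relative
    error of such a value with respect to 0 is infinite. *)
Lemma cinv_kl_zero S k l a : inv_dom S a -> invmx a k l = 0 ->
  ~ cofactor_vanishes (mx_support a) l k -> cinv_kl S k l a = +oo%E.
Proof.
move=> Da akl nvan; apply: cinv_kl_cvg.
have [Sa /negP/negPn ua] := Da.
have [y [ya ykl]] : exists y, supported_mx (mx_support a) y /\ cofactor y l k <> 0.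
  move/existsNP: nvan => [y /not_implyP [? ?]]; by exists y.
have [r r0 ra] := invmx_near ua ltr01.
pose c := \sum_i \sum_j `|y i j - a i j| / `|a i j|.
have c0 : 0 <= c by do 2!apply: sumr_ge0 => ? _; exact: divr_ge0.
have yc i j : `|y i j - a i j| <= c * `|a i j|.
  have [aij|aij] := eqVneq (a i j) 0.
    by rewrite ya ?inE /= ?aij ?eqxx// subrr normr0 mulr0.
  rewrite -ler_pdivrMr ?normr_gt0// /c (bigD1 i)//= (bigD1 j)//= -addrA.
  rewrite ler_wpDr// addr_ge0//; first by apply: sumr_ge0 => ? _; exact: divr_ge0.
  by do 2!apply: sumr_ge0 => ? _; exact: divr_ge0.
have na0 : 0 < 1 + mx_norm a by rewrite ltr_pwDl//; exact: (normr_ge0 a).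
apply: cvg_near_cst; near=> delta.
have d0 : 0 < delta by near: delta; exact: nbhs_right_gt.
have dr : delta * (1 + mx_norm a) <= r.
  rewrite -ler_pdivlMr//; near: delta; apply: nbhs_right_le.
  by rewrite divr_gt0.
have [u /andP[u0 ud] ukl] : exists2 u, 0 < u < delta / (c + 1) &
    cofactor (a + u *: (y - a)) l k <> 0.
  apply: contrapT => h; apply: ykl.
  rewrite -[y](subrK a) addrC -[y - a]scale1r.
  apply: (@cofactor_line_eq0 _ _ _ _ _ _ (delta / (c + 1))).
    by rewrite divr_gt0// ltr_wpDl.
  by move=> u hu; apply: contrapT => ukl; apply: h; exists u.
pose x := a + u *: (y - a).
have xa i j : `|x i j - a i j| <= delta * `|a i j|.
  rewrite !mxE addrC addKr normrM gtr0_norm//.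
  rewrite (@le_trans _ _ (u * (c * `|a i j|)))//; first by rewrite ler_wpM2l// ltW.
  rewrite mulrA ler_wpM2r//; move: ud; rewrite ltr_pdivlMr ?ltr_wpDl// => /ltW.
  by apply: le_trans; rewrite ler_wpM2l ?lerDl// ltW.
have bx : cball a delta x by apply/(cdist_le _ _ (ltW d0)).
have [ux _] := ra x (cball_entry_le (ltW d0) dr bx).
have Dx : (cball a delta `&` @inv_dom R n S) x.
  by split=> //; split; [exact: cball_supported bx (ltW d0)|exact/negP/negPn].
have nxa : x <> a.
  move=> xea; apply: ukl; rewrite -/x xea.
  have deta : \det a != 0 by rewrite -unitfE -unitmxE.
  move: akl; rewrite invmx_entryE// => /eqP.
  by rewrite mulf_eq0 invr_eq0 (negbTE deta) orbF => /eqP.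
apply/eqP; rewrite -leye_eq; apply: ereal_sup_ubound; right.
exists x => //.
have xkl : invmx x k l != 0.
  rewrite invmx_entryE// mulf_neq0//; first exact/eqP.
  by rewrite invr_eq0 -unitfE -unitmxE.
rewrite cdist_scalar akl /cratio eqxx /= subr0 (negbTE xkl)/=.
have dx0 := cdist_gt0 nxa; rewrite /cball /= in bx.
case: (cdist x a) dx0 bx => // e; rewrite lte_fin => e0 _.
by rewrite inver gt_eqF// gt0_mulye// lte_fin invr_gt0.
Unshelve. all: by end_near. Qed.

Definition cinv_value k l a : R :=
  (\sum_i \sum_j `|invmx a k i * a i j * invmx a j l|) / `|invmx a k l|.

(** By the resolvent identity the quotient at x is
    |sum_ij (x^-1)_ki (x_ij - a_ij) (a^-1)_jl| / (|(a^-1)_kl| d(x, a)), and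
    |x_ij - a_ij| <= d(x, a) |a_ij|.  Since x^-1 tends to a^-1, the triangle
    inequality gives the upper bound; signs chosen to align all the terms make
    it sharp. *)
Lemma cinv_kl_nonzero S k l a : inv_dom S a -> invmx a k l != 0 ->
  cinv_kl S k l a = (cinv_value k l a)%:E.
Proof.
move=> Da akl; apply: cinv_kl_cvg.
have [Sa /negP/negPn ua] := Da.
have Fa0 : 0 < `|invmx a k l| by rewrite normr_gt0.
(* e' W is the error made when x^-1 is replaced by a^-1 up to e'. *)
pose W := (\sum_i \sum_j `|a i j * invmx a j l|) / `|invmx a k l|.
have W0 : 0 <= W.
  by rewrite divr_ge0//; do 2!apply: sumr_ge0 => ? _.
have na0 : 0 < 1 + mx_norm a by rewrite ltr_pwDl//; exact: (normr_ge0 a).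
have [i0 [j0 a0]] := unitmx_neq0 k ua.
suff key : forall e, 0 < e -> \forall delta \near 0^'+,
    ((cinv_value k l a - e)%:E <=
     ereal_sup (0%E |` quotients S k l a delta) <=
     (cinv_value k l a + e)%:E)%E.
  apply/fine_cvgP; split.
    have := key _ ltr01; apply: filterS => delta.
    by case: (ereal_sup _) => // /andP[].
  apply/cvgrPdist_le => e e0; have := key _ e0; apply: filterS => delta /=.
  case: (ereal_sup _) => [s| |] /andP[]//=; rewrite ?lee_fin.
  by move=> h1 h2; rewrite ler_norml; lra.
move=> e e0.
pose e' := e / (W + 1).
have W1 : 0 < W + 1 by rewrite ltr_wpDl.
have e'0 : 0 < e' by rewrite divr_gt0.
have e'W : e' * W <= e.
  rewrite /e' mulrAC ler_pdivrMr// ler_wpM2l ?lerDl// ltW//.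
have [r r0 ra] := invmx_near ua e'0.
near=> delta.
have d0 : 0 < delta by near: delta; exact: nbhs_right_gt.
have dr : delta * (1 + mx_norm a) <= r.
  rewrite -ler_pdivlMr//; near: delta; apply: nbhs_right_le.
  by rewrite divr_gt0.
have ball_r x := @cball_entry_le a x delta r (ltW d0) dr.
have quotE x : x <> a -> cball a delta x ->
    exists2 c, 0 < c <= delta & cdist x a = c%:E /\
    (cdist ((invmx x k l)%:M : 'M[R]_1) ((invmx a k l)%:M : 'M[R]_1) / cdist x a)%E
    = (`|\sum_i \sum_j invmx x k i * (x i j - a i j) * invmx a j l|
       / `|invmx a k l| / c)%:E.
  move=> xa bx; have [ux _] := ra x (ball_r _ bx).
  move: (cdist_gt0 xa) bx; rewrite /cball /=.
  case: (cdist x a) => // c; rewrite lte_fin lee_fin => c0 cd.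
  exists c; first by rewrite c0.
  split=> //.
  rewrite cdist_scalar /cratio akl invmx_diff// inver gt_eqF//=.
  by rewrite normrM normrN normfV.
apply/andP; split.
  (* The perturbation with relative size delta that aligns all the terms. *)
  pose s i j : R := if 0 <= invmx a k i * a i j * invmx a j l then 1 else -1.
  have ns i j : `|s i j| = 1 by rewrite /s; case: ifP; rewrite ?normrN normr1.
  have sE i j : s i j * (invmx a k i * a i j * invmx a j l) =
      `|invmx a k i * a i j * invmx a j l|.
    rewrite /s; case: ifP => [h|/negbT]; first by rewrite mul1r ger0_norm.
    by rewrite -ltNge mulN1r => h; rewrite ltr0_norm.
  pose x : 'M[R]_n := \matrix_(i, j) (a i j * (1 + delta * s i j)).
  have xaE i j : x i j - a i j = delta * s i j * a i j by rewrite !mxE; ring.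
  have bx : cball a delta x.
    apply/(cdist_le _ _ (ltW d0)) => i j.
    by rewrite xaE !normrM ns mulr1 (gtr0_norm d0).
  have xa : x <> a.
    move=> xea; have := xaE i0 j0; rewrite xea subrr => /esym/eqP.
    rewrite !mulf_eq0 (negbTE a0) gt_eqF//= -normr_eq0 ns oner_eq0//.
  have [ux xinv] := ra x (ball_r _ bx).
  have [c /andP[c0 cd] [_ qE]] := quotE x xa bx.
  apply: (@le_trans _ _ (`|\sum_i \sum_j invmx x k i * (x i j - a i j) * invmx a j l|
       / `|invmx a k l| / c)%:E); last first.
    rewrite -qE; apply: ereal_sup_ubound; right; exists x => //.
    by split=> //; split=> //; split; [exact: cball_supported bx (ltW d0)|
      exact/negP/negPn].
  rewrite lee_fin ler_pdivlMr//.
  have [h|h] := lerP 0 (cinv_value k l a - e); last first.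
    by rewrite (@le_trans _ _ 0)// ?mulr_le0_ge0 ?ltW// divr_ge0.
  apply: (@le_trans _ _ ((cinv_value k l a - e) * delta)).
    by rewrite ler_wpM2l.
  apply: (@le_trans _ _ ((cinv_value k l a - e' * W) * delta)).
    by rewrite ler_wpM2r ?(ltW d0)// lerD2l lerN2.
  rewrite ler_pdivlMr// /cinv_value /W mulrA -mulrBl mulrAC mulfVK ?gt_eqF//.
  have -> : \sum_i \sum_j invmx x k i * (x i j - a i j) * invmx a j l =
     \sum_i \sum_j delta * `|invmx a k i * a i j * invmx a j l| +
     \sum_i \sum_j delta * ((invmx x k i - invmx a k i) * s i j *
                            (a i j * invmx a j l)).
    rewrite -big_split /=; apply: eq_bigr => i _.
    rewrite -big_split /=; apply: eq_bigr => j _.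
    by rewrite xaE -sE; ring.
  apply: le_trans (ler_norm _).
  rewrite mulrC mulrBr !mulr_sumr lerD//.
    by apply: ler_sum => i _; rewrite mulr_sumr.
  rewrite -sumrN; apply: ler_sum => i _.
  rewrite !mulr_sumr -sumrN; apply: ler_sum => j _.
  rewrite -mulrN ler_wpM2l ?(ltW d0)//.
  rewrite lerNl (le_trans (ler_norm _))// normrN !normrM ns mulr1 -normrM.
  by rewrite ler_wpM2r//.
apply: ge_ereal_sup => _ [->|[x [[bx _] xa] <-]].
  by rewrite lee_fin addr_ge0 ?(ltW e0)// divr_ge0//; do 2!apply: sumr_ge0 => ? _.
have [ux xinv] := ra x (ball_r _ bx).
have [c /andP[c0 cd] [cE ->]] := quotE x xa bx.
rewrite lee_fin ler_pdivrMr//.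
apply: (@le_trans _ _ ((cinv_value k l a + e' * W) * c)); last first.
  by rewrite ler_wpM2r ?(ltW c0)// lerD2l.
rewrite ler_pdivrMr// /cinv_value /W mulrA -mulrDl mulrAC mulfVK ?gt_eqF//.
have xac i j : `|x i j - a i j| <= c * `|a i j|.
  by move: i j; apply/(cdist_le _ _ (ltW c0)); rewrite cE.
rewrite (le_trans (ler_norm_sum _ _ _))// mulrC mulrDr !mulr_sumr -big_split.
apply: ler_sum => i _ /=; rewrite (le_trans (ler_norm_sum _ _ _))//.
rewrite !mulr_sumr -big_split; apply: ler_sum => j _ /=.
rewrite !normrM [leRHS](_ : _ =
  (`|invmx a k i| + e') * (c * `|a i j| * `|invmx a j l|)); last by ring.
rewrite -mulrA; apply: ler_pM => //.
  have := xinv k i; have := ler_normD (invmx x k i - invmx a k i) (invmx a k i).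
  by rewrite subrK; lra.
by rewrite ler_wpM2r.
Unshelve. all: by end_near. Qed.

End condition_number.

(** * Reduction to the determinant and one cofactor *)

Section sensitivity.
Variables (R : realType) (n : nat).
Implicit Types (S : {set 'I_n * 'I_n}) (g : 'M[R]_n -> R) (a : 'M[R]_n)
  (i j k l : 'I_n) (s t : R).

Definition entry_term g a (ij : 'I_n * 'I_n) : R :=
  `|a ij.1 ij.2 * entry_slope g ij.1 ij.2 a|.

(** The entry (k, l) of the inverse is cof / det, and the closed form is the
    weighted sum of its absolute logarithmic derivatives; Jacobi's identity
    splits each of them into the contributions of det and of cof. *)
Lemma cinv_value_le S k l a : supported_mx S a -> a \in unitmx ->
  cofactor a l k != 0 ->
  cinv_value k l a <=
  \sum_(ij in S) (entry_term determinant a ij / `|\det a|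
    + entry_term (fun x => cofactor x l k) a ij / `|cofactor a l k|).
Proof.
move=> Sa ua c0; have d0 : \det a != 0 by rewrite -unitfE -unitmxE.
rewrite /cinv_value pair_big mulr_suml (bigID (mem S)) /= [X in _ + X]big1 ?addr0.
  apply: ler_sum => -[i j] ijS; rewrite /entry_term /= det_slope !invmx_entryE//.
  have -> : `|cofactor a i k / \det a * a i j * (cofactor a l j / \det a)| /
      `|cofactor a l k / \det a| =
      `|a i j * cofactor a i j / \det a
      - a i j * entry_slope (fun x => cofactor x l k) i j a / cofactor a l k|.
    rewrite -normf_div; congr `|_|.
    have := cofactor_jacobi a i j k l.
    set x := cofactor a i k; set y := cofactor a l j; set z := cofactor a l k.
    move=> xy; rewrite [LHS](_ : _ = a i j * (x * y) / (z * \det a)); last by field; apply/andP.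
    by rewrite xy; field; apply/andP.
  by rewrite (le_trans (ler_normB _ _))// !normf_div.
by move=> [i j] /= ijS; rewrite Sa// mulr0 mul0r normr0 mul0r.
Qed.

(** If some [cinv_kl] exceeds t then 2 |S| ratios add up to more than t, so one
    of them exceeds t / (2 |S|). *)
Lemma cinv_gt S a t : inv_dom S a -> 0 < t -> (0 < #|S|)%N ->
  (forall k l, cofactor a l k != 0 \/ @cofactor_vanishes R n S l k) ->
  (t%:E < cinv S a)%E -> let s := t / (2 * #|S|%:R) in
  exists k l ij, ij \in S /\
    (s * `|\det a| < entry_term determinant a ij \/
     s * `|cofactor a l k| < entry_term (fun x => cofactor x l k) a ij).
Proof.
move=> Da t0 S0 cof tc s; move: tc; rewrite /cinv mem_set// => tc.
have [Sa /negP/negPn ua] := Da.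
have d0 : \det a != 0 by rewrite -unitfE -unitmxE.
apply: contrapT => h; move: tc; apply/negP; rewrite -leNgt.
apply/bigmax_leP; split => [|k _]; first by rewrite lee_fin ltW.
apply/bigmax_leP; split => [|l _]; first by rewrite lee_fin ltW.
have [c0|c0] := eqVneq (cofactor a l k) 0.
  have [|van] := cof k l; first by rewrite c0 eqxx.
  rewrite cinv_kl_vanishing ?lee_fin ?ltW// => y ya; apply: van.
  exact: supported_mxS (mx_support_sub Sa) ya.
rewrite cinv_kl_nonzero//; last by rewrite invmx_entryE// mulf_neq0// invr_neq0.
rewrite lee_fin (le_trans (cinv_value_le Sa ua c0))//.
apply: (@le_trans _ _ (\sum_(ij in S) (s + s))).
  apply: ler_sum => ij ijS.
  rewrite lerD// ler_pdivrMr ?normr_gt0// leNgt; apply/negP => hs; apply: h.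
    by exists k, l, ij; split=> //; left.
  by exists k, l, ij; split=> //; right.
rewrite sumr_const -mulr_natr /s.
by rewrite le_eqVlt; apply/orP; left; apply/eqP; field; rewrite pnatr_eq0 -lt0n.
Qed.

End sensitivity.

(** * Measurability of the condition number *)

Lemma measurable_event (d : measure_display) (T : measurableType d)
    (b : T -> bool) :
  measurable_fun setT b -> measurable [set w | b w].
Proof. by move=> /(_ measurableT [set true] I); rewrite setTI. Qed.

Section measurability.
Variables (R : realType) (n : nat).

(** Borel functions of a matrix, phrased through composition with measurable
    entries; this form applies to any sigma-algebra on the source, in
    particular to the one generated by some of the entries. *)
Definition borel_mx (m : nat) (g : 'M[R]_m -> R) : Prop :=
  forall d (T : measurableType d) (A : T -> 'M[R]_m),
    (forall i j, measurable_fun setT (fun w => A w i j)) ->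
    measurable_fun setT (fun w => g (A w)).

Lemma borel_det (m : nat) : borel_mx (@determinant R m).
Proof.
move=> d T A mA; apply: measurable_sum => s; apply: measurable_funM => //.
by apply: measurable_prod => i _; exact: mA.
Qed.

Lemma measurable_eq0 (d : measure_display) (T : measurableType d) (g : T -> R) :
  measurable_fun setT g -> measurable [set w | g w = 0].
Proof.
move=> mg; rewrite (_ : [set w | g w = 0] = [set w | g w == 0]); last first.
  by apply/seteqP; split=> w /eqP.
by apply: measurable_event; exact: measurable_fun_eqr.
Qed.

Lemma borel_cofactor (l k : 'I_n) : borel_mx (fun a : 'M[R]_n => cofactor a l k).
Proof.
move=> d T A mA; apply: measurable_funM => //; apply: borel_det => i j.
by under eq_fun do rewrite !mxE; exact: mA.
Qed.

Variables (d : measure_display) (T : measurableType d) (A : T -> 'M[R]_n).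
Hypothesis mA : forall i j, measurable_fun setT (fun w => A w i j).
Implicit Types (S : {set 'I_n * 'I_n}).

Lemma measurable_inv_abs (f : T -> R) : measurable_fun setT f ->
  measurable_fun setT (fun w => `|f w|^-1).
Proof.
move=> mf; under eq_fun do rewrite -powR_inv1//.
apply: (measurableT_comp (measurable_powR (-1))).
exact: measurableT_comp mf.
Qed.

Lemma measurable_support (Q : {set 'I_n * 'I_n} -> bool) :
  measurable_fun setT (fun w => Q (mx_support (A w))).
Proof.
apply: (measurable_fun_bool true); rewrite setTI.
rewrite [X in measurable X](_ : _ = \bigcup_(Z in [set Z | Q Z])
   \bigcap_(ij in [set: 'I_n * 'I_n])
      [set w | (A w ij.1 ij.2 != 0) == (ij \in Z)]); last first.
  apply/seteqP; split => w /=.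
    by move=> Qw; exists (mx_support (A w)) => //= ij _ /=; rewrite inE.
  move=> [Z /= QZ h]; suff -> : mx_support (A w) = Z by [].
  by apply/setP => ij; rewrite inE; have /eqP := h ij I.
apply: fin_bigcup_measurable => // Z _; apply: fin_bigcap_measurable => // ij _.
have : measurable_fun setT (fun w => A w ij.1 ij.2 == 0).
  by apply: measurable_fun_eqr => //; exact: mA.
move=> /measurable_neg /(_ measurableT [set (ij \in Z)]) /(_ Logic.I).
rewrite setTI; congr measurable; apply/seteqP.
by split => w /=; [move=> ->|move/eqP].
Qed.

Lemma inv_domE S (a : 'M[R]_n) :
  (a \in @inv_dom R n S) = (mx_support a \subset S) && (\det a != 0).
Proof.
apply/idP/andP.
  rewrite inE => -[Sa /negP/negPn ua]; split; first exact: mx_support_sub.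
  by rewrite -unitfE -unitmxE.
move=> [sS d0]; rewrite inE; split.
  exact: supported_mxS sS (@supported_mx_support R n a).
by apply/negP/negPn; rewrite unitmxE unitfE.
Qed.

(** The closed form is a rational expression in the entries, except where the
    cofactor is zero: there the value only depends on the support of the
    matrix, which takes finitely many values. *)
Lemma measurable_cinv S : measurable_fun setT (fun w => cinv S (A w)).
Proof.
pose h k l (a : 'M[R]_n) : \bar R :=
  if cofactor a l k == 0 then
    if `[< @cofactor_vanishes R n (mx_support a) l k >] then 0%E else +oo%E
  else ((\sum_i \sum_j `|cofactor a i k * a i j * cofactor a l j|) *
     `|\det a|^-1 * `|cofactor a l k|^-1)%:E.
have hE k l a : a \in @inv_dom R n S -> cinv_kl S k l a = h k l a.
  move=> /set_mem Da; have [Sa /negP/negPn ua] := Da.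
  have d0 : \det a != 0 by rewrite -unitfE -unitmxE.
  rewrite /h; have [c0|c0] := eqVneq (cofactor a l k) 0.
    case: asboolP => [|nv]; first exact: cinv_kl_vanishing.
    by rewrite cinv_kl_zero// invmx_entryE// c0 mul0r.
  rewrite cinv_kl_nonzero//; last by rewrite invmx_entryE// mulf_neq0// invr_neq0.
  congr (_%:E); rewrite /cinv_value !mulr_suml; apply: eq_bigr => i _.
  rewrite !mulr_suml; apply: eq_bigr => j _.
  rewrite !invmx_entryE//.
  move: (cofactor a l k) (cofactor a i k) (cofactor a l j) (\det a) c0 d0.
  move=> z x y t z0 t0; rewrite !normrM !normfV; field.
  by rewrite !normr_eq0 z0 t0.
have -> : (fun w => cinv S (A w)) = (fun w =>
    if (mx_support (A w) \subset S) && (\det (A w) != 0) then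
      \big[maxe/0%E]_(k < n) \big[maxe/0%E]_(l < n) h k l (A w) else +oo%E).
  apply/funext => w; rewrite /cinv -inv_domE; case: ifP => // Dw.
  by apply: eq_bigr => k _; apply: eq_bigr => l _; exact: hE.
have mdet : measurable_fun setT (fun w => \det (A w)) by exact: borel_det.
have mcof l k : measurable_fun setT (fun w => cofactor (A w) l k).
  exact: borel_cofactor.
have mmax (F : 'I_n -> T -> \bar R) : (forall k, measurable_fun setT (F k)) ->
    measurable_fun setT (fun w => \big[maxe/0%E]_(k < n) F k w).
  move=> mF; elim: (index_enum _) => [|k s ih].
    by under eq_fun do rewrite big_nil; exact: measurable_cst.
  by under eq_fun do rewrite big_cons; exact: measurable_maxe.
apply: measurable_fun_ifT => //.
  apply: measurable_and; first exact: (measurable_support (fun Z => Z \subset S)).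
  by apply: measurable_neg; exact: measurable_fun_eqr.
apply: (mmax) => k; apply: (mmax) => l; apply: measurable_fun_ifT.
- exact: measurable_fun_eqr.
- apply: measurable_fun_ifT => //.
  exact: (measurable_support (fun Z => `[< @cofactor_vanishes R n Z l k >])).
- apply/measurable_EFinP; apply: measurable_funM; last exact: measurable_inv_abs.
  apply: measurable_funM; last exact: measurable_inv_abs.
  apply: measurable_sum => i; apply: measurable_sum => j.
  apply: (measurableT_comp (@normr_measurable R setT)).
  by apply: measurable_funM => //; apply: measurable_funM.
Qed.

End measurability.

(** * Conditioning on all variables but one *)

Section conditioning.
Context (d : measure_display) (T : measurableType d) (R : realType)
  (P : probability T R) (I : finType) (X : I -> {RV P >-> R}).
Implicit Types (J K : {set I}) (i : I).

Definition cylinders K : set (set T) :=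
  [set C | exists2 B : I -> set R, (forall i, measurable (B i)) &
    C = [set w | forall i, i \in K -> B i (X i w)]].

(** The underlying set T with the sigma-algebra generated by the X i, i in K. *)
Definition sigma_of K := g_sigma_algebraType (cylinders K).

Lemma cylinders_setI K : setI_closed (cylinders K).
Proof.
move=> _ _ [B mB ->] [C mC ->]; exists (fun i => B i `&` C i).
  by move=> i; exact: measurableI.
apply/seteqP; split=> w /=; first by move=> [hB hC] i iK; split; auto.
by move=> h; split=> i iK; have [] := h i iK.
Qed.

Lemma cylinders_measurable K : cylinders K `<=` measurable.
Proof.
move=> _ [B mB ->].
rewrite [X in measurable X](_ : _ =
    \bigcap_(i in [set` K]) (X i @^-1` B i)); last first.
  by apply/seteqP; split=> w h i /=; [exact: h|move=> iK; exact: (h i)].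
apply: fin_bigcap_measurable => // i _.
by rewrite -[_ @^-1` _]setTI; exact: measurable_funPT.
Qed.

Lemma sigma_of_measurable K (C : set T) :
  measurable (C : set (sigma_of K)) -> measurable C.
Proof.
move: C; apply: smallest_sub; last exact: cylinders_measurable.
exact: sigma_algebra_measurable.
Qed.

Lemma measurable_sigma_of K i : i \in K ->
  measurable_fun setT (X i : sigma_of K -> R).
Proof.
move=> iK _ B mB; rewrite setTI; apply: sub_sigma_algebra.
exists (fun j => if j == i then B else setT).
  by move=> j; case: ifP.
apply/seteqP; split => w /= h; last by have := h i iK; rewrite eqxx.
by move=> j _; case: eqP => [->|].
Qed.

(** Both sides are finite measures in C; they agree on cylinders by the product
    rule, and cylinders form a pi-system. *)
Lemma indep_sigma_of J i (B : set R) (C : set T) : independent_RVs J X ->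
  i \in J -> measurable B -> measurable (C : set (sigma_of (J :\ i))) ->
  P (C `&` X i @^-1` B) = (P (X i @^-1` B) * P C)%E.
Proof.
move=> indX iJ mB mC; set K := J :\ i in mC *.
have mXB : measurable (X i @^-1` B).
  by rewrite -[_ @^-1` _]setTI; exact: measurable_funPT.
have pfin : P (X i @^-1` B) \is a fin_num by exact: fin_num_measure.
have p0 : 0 <= fine (P (X i @^-1` B)) by exact: fine_ge0.
pose m1 := mrestr P mXB; pose m2 := mscale (NngNum p0) P.
suff : m1 C = m2 C by rewrite /m2 /mscale /= fineK.
pose H := [set Y | cylinders K Y /\ Y `<=` setT].
have HE : H = cylinders K by apply/seteqP; split=> Y //= [].
have := @g_sigma_algebra_measure_unique_trace _ R T (cylinders K) setT
  measurableT; rewrite -/H HE; apply=> //.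
- exact: cylinders_measurable.
- exact: cylinders_setI.
- by rewrite /= /mrestr /mscale/= setTI probability_setT mule1 fineK.
- move=> _ [D mD ->]; rewrite /= /mrestr /mscale/= fineK//.
  have h1 := indX (i |: K) (fun j => if j == i then B else D j).
  have h2 := indX K D.
  have KJ : K \subset J by exact: subD1set.
  have iK : i \notin K by rewrite !inE eqxx.
  rewrite h2//; move: h1; rewrite big_setU1//= eqxx.
  under eq_bigr => j jK.
    have /negbTE -> : j != i by apply: contraNneq iK => <-.
    over.
  move=> <-.
  - congr (P _); apply/seteqP; split => w /=.
      move=> [h Bw] j; rewrite in_setU1 => /orP[/eqP ->|jK].
        by rewrite eqxx.
      by case: eqP => [->//|_]; exact: h.
    move=> h; split; last by have := h i; rewrite setU11 eqxx; exact.
    move=> j jK; have := h j; rewrite in_setU1 jK orbT => /(_ isT).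
    by case: eqP => // ji; move: iK; rewrite -ji jK.
  - by rewrite finset.subUset finset.sub1set iJ.
  - by move=> j _; case: ifP.
- rewrite /= /mrestr setTI; apply: le_lt_trans (ltry 1%R).
  exact: probability_le1.
Qed.

(** By independence the joint law of the other variables and of X i is a product
    measure, so Fubini's theorem computes the probability by integrating the
    probabilities of the sections. *)
Lemma prob_section_le J i (E : set (sigma_of (J :\ i) * R)) (c : \bar R) :
  independent_RVs J X -> i \in J -> measurable E ->
  (forall w, distribution P (X i) [set x | E (w, x)] <= c)%E ->
  (P [set w | E (w, X i w)] <= c)%E.
Proof.
move=> indX iJ mE hE.
have mid : measurable_fun setT (idfun : T -> sigma_of (J :\ i)).
  by move=> _ C mC; rewrite setTI; exact: sigma_of_measurable mC.
pose Y : {RV P >-> sigma_of (J :\ i)} := mfun_Sub (mem_set mid).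
have mZ : measurable_fun setT (fun w : T => (w : sigma_of (J :\ i), X i w)).
  by apply/measurable_fun_pairP; split=> //; exact: measurable_funPT.
pose Z : {RV P >-> (sigma_of (J :\ i) * R)%type} := mfun_Sub (mem_set mZ).
rewrite -[P _]/(distribution P Z E).
have := @product_measure_unique _ _ _ _ R (distribution P Y)
  (distribution P (X i)) (distribution P Z).
move=> /(_ _ E mE) <-; last first.
  move=> C B mC mB; rewrite /= /distribution /pushforward /=.
  by rewrite muleC -(indep_sigma_of indX iJ).
rewrite /product_measure1.
apply: (@le_trans _ _ (\int[distribution P Y]_x (cst c x))%E); last first.
  rewrite integral_cst//= /distribution /pushforward preimage_setT.
  by rewrite probability_setT mule1.
apply: ge0_le_integral => //.
  exact: measurable_fun_xsection.
move=> w _ /=; apply: le_trans (hE w).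
by rewrite /xsection; under eq_set do rewrite inE.
Qed.

End conditioning.

(** * A Gaussian estimate *)

Section gaussian_estimates.
Variable R : realType.
Implicit Types (m sigma c s x M N : R).

(** With y = |x - m| / sigma one has |x| <= 1 + sigma y, while both
    exp(- y^2 / 2) and y exp(- y^2 / 2) are at most 1. *)
Lemma normr_mul_normal_pdf_le m sigma x : 0 < sigma -> `|m| <= 1 ->
  `|x| * normal_pdf m sigma x <= (1 + sigma) * normal_peak sigma.
Proof.
move=> s0 m1; rewrite normal_pdfE ?gt_eqF// mulrCA mulrC ler_wpM2r//.
  exact: normal_peak_ge0.
pose y := `|x - m| / sigma.
have y0 : 0 <= y by rewrite divr_ge0// ltW.
have xy : `|x| <= 1 + sigma * y.
  rewrite /y mulrC divfK ?gt_eqF//.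
  by have := ler_normD (x - m) m; rewrite subrK; lra.
have -> : normal_fun m sigma x = (expR (y ^+ 2 / 2))^-1.
  rewrite -expRN /normal_fun; congr expR.
  by rewrite /y expr_div_n real_normK ?num_real// -mulr_natr; field; rewrite gt_eqF.
rewrite ler_pdivrMr ?expR_gt0// (le_trans xy)//.
apply: (@le_trans _ _ ((1 + sigma) * (1 + y ^+ 2 / 2))).
  by have := sqr_ge0 (y - 1); rewrite expr2; nra.
by rewrite ler_wpM2l ?addr_ge0 ?(ltW s0)// expR_ge1Dx.
Qed.

Lemma normal_peak_sqrt sigma : 0 < sigma ->
  2 * ((1 + sigma) * normal_peak sigma) =
  (1 + sigma) / sigma * Num.sqrt (2 / pi).
Proof.
move=> s0; rewrite /normal_peak.
move: (@trigo.pi R) (@pi_gt0 R) => p p0.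
have q0 : 0 < Num.sqrt (2 / p) by rewrite sqrtr_gt0 divr_gt0.
have -> : Num.sqrt (sigma ^+ 2 * p *+ 2) = sigma * (2 / Num.sqrt (2 / p)).
  rewrite -[RHS]ger0_norm; last by rewrite mulr_ge0 ?(ltW s0)// divr_ge0 ?(ltW q0).
  rewrite -sqrtr_sqr; congr Num.sqrt.
  rewrite exprMn expr_div_n sqr_sqrtr ?divr_ge0 ?(ltW p0)//.
  by rewrite -mulr_natr; field; rewrite gt_eqF.
by field; rewrite !gt_eqF.
Qed.

Lemma measurable_affine_ratio_fun (d : measure_display) (T : measurableType d)
    s (f1 f2 f3 : T -> R) :
  measurable_fun setT f1 -> measurable_fun setT f2 -> measurable_fun setT f3 ->
  measurable_fun setT
    (fun w => s * `|f3 w * f1 w + f2 w| < `|f3 w * f1 w|).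
Proof.
move=> m1 m2 m3; apply: measurable_fun_ltr.
  apply: measurable_funM => //; apply: (measurableT_comp (@normr_measurable R setT)).
  by apply: measurable_funD => //; exact: measurable_funM.
apply: (measurableT_comp (@normr_measurable R setT)).
exact: measurable_funM.
Qed.

Lemma measurable_affine_ratio s M N :
  measurable [set x | s * `|x * M + N| < `|x * M|].
Proof. by apply: measurable_event; exact: measurable_affine_ratio_fun. Qed.

(** Squaring turns the condition into a quadratic inequality in x, and
    completing the square gives the centre and the radius. *)
Lemma affine_ratio_sub_ball c s : 1 < s ->
  [set x | s * `|x + c| < `|x|] `<=`
  ball (- (s ^+ 2 * c / (s ^+ 2 - 1))) (`|c| * s / (s ^+ 2 - 1)).
Proof.
move=> s1 x /= h.
have s2 : 0 < s ^+ 2 - 1 by rewrite subr_gt0 expr_gt1// ltW// (lt_trans _ s1).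
rewrite /ball /= ltr_pdivlMr// -[X in _ * X < _](gtr0_norm s2) -normrM.
have -> : (- (s ^+ 2 * c / (s ^+ 2 - 1)) - x) * (s ^+ 2 - 1) =
    - (s ^+ 2 * c + (s ^+ 2 - 1) * x) by field; rewrite gt_eqF.
have s0 : 0 < s by rewrite (lt_trans _ s1).
rewrite normrN -[X in _ < _ * X](gtr0_norm s0) -normrM.
have h2 : (s * (x + c)) ^+ 2 < x ^+ 2.
  rewrite -(@real_normK _ (s * _)) ?num_real// -(@real_normK _ x) ?num_real//.
  by rewrite ltr_pXn2r ?nnegrE// normrM gtr0_norm.
rewrite -(@ltr_pXn2r _ 2) ?nnegrE// !real_normK ?num_real//.
rewrite -subr_gt0 [ltRHS](_ : _ =
  (s ^+ 2 - 1) * (x ^+ 2 - (s * (x + c)) ^+ 2)); last by ring.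
by rewrite mulr_gt0// subr_gt0.
Qed.

(** Dividing by M leaves the condition s |x + c| < |x| with c = N / M.  It forces
    |x| >= x0 = |c| s / (s + 1), so the density is at most a constant over x0 on
    the event, which lies in an interval of length 2 x0 / (s - 1). *)
Lemma normal_prob_affine_ratio_le m sigma s M N : 0 < sigma -> `|m| <= 1 ->
  1 < s ->
  (normal_prob m sigma [set x | (s * `|x * M + N| < `|x * M|)%R] <=
   ((1 + sigma) / sigma * Num.sqrt (2 / pi) / (s - 1))%:E)%E.
Proof.
move=> sg0 m1 s1; have s0 : 0 < s by rewrite (lt_trans _ s1).
have bound0 : 0 <= (1 + sigma) / sigma * Num.sqrt (2 / pi) / (s - 1).
  by rewrite divr_ge0 ?subr_ge0 ?(ltW s1)// mulr_ge0 ?sqrtr_ge0// divr_ge0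
    ?addr_ge0 ?(ltW sg0).
set Z := [set x | _].
have [Z0|] := eqVneq Z set0.
  by rewrite Z0 measure0 lee_fin.
move=> /set0P [z Zz].
have M0 : M != 0.
  apply: contraPneq Zz => M0; rewrite /Z /= M0 !mulr0 normr0 add0r.
  by apply/negP; rewrite -leNgt mulr_ge0 ?(ltW s0).
pose c := N / M.
have ZE : Z = [set x | s * `|x + c| < `|x|].
  apply/seteqP; split => x; rewrite /Z /= -[N](divfK M0) -/c -mulrDl !normrM
    mulrA ltr_pM2r// normr_gt0//.
have c0 : 0 < `|c|.
  rewrite normr_gt0; apply: contraPneq Zz => c0; rewrite ZE /= c0 addr0.
  by apply/negP; rewrite -leNgt ler_peMl// ltW.
have s2 : 0 < s ^+ 2 - 1 by rewrite subr_gt0 expr_gt1// ltW.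
pose x0 := `|c| * s / (s + 1).
have x00 : 0 < x0 by rewrite divr_gt0 ?mulr_gt0 ?addr_gt0.
have Zx0 x : Z x -> x0 <= `|x|.
  rewrite ZE /= => h; rewrite /x0 ler_pdivrMr ?addr_gt0//.
  have := ler_normB (x + c) x; rewrite addrAC subrr add0r => h2.
  by have : s * `|c| <= s * (`|x + c| + `|x|); [rewrite ler_pM2l|nra].
pose rho := `|c| * s / (s ^+ 2 - 1).
pose K := (1 + sigma) * normal_peak sigma.
have K0 : 0 <= K by rewrite mulr_ge0 ?normal_peak_ge0 ?addr_ge0 ?(ltW sg0).
have mZ : measurable Z by exact: measurable_affine_ratio.
rewrite /normal_prob.
apply: (@le_trans _ _ (\int[lebesgue_measure]_(x in Z) (K / x0)%:E)%E).
  apply: ge0_le_integral => //.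
  - by move=> x _; rewrite lee_fin normal_pdf_ge0.
  - by apply/measurable_EFinP; apply: measurable_funTS; exact: measurable_normal_pdf.
  - move=> x Zx; rewrite lee_fin ler_pdivlMr//.
    apply: le_trans (normr_mul_normal_pdf_le x sg0 m1).
    by rewrite mulrC ler_wpM2r ?normal_pdf_ge0// Zx0.
rewrite integral_cst//.
apply: (@le_trans _ _ ((K / x0)%:E * (rho *+ 2)%:E)%E).
  rewrite lee_wpmul2l ?lee_fin ?(divr_ge0 K0 (ltW x00))//.
  rewrite -(lebesgue_measure_ball (- (s ^+ 2 * c / (s ^+ 2 - 1)))).
    by apply: le_measure; rewrite ?inE//; [exact: measurable_ball|
      rewrite ZE; exact: affine_ratio_sub_ball].
  by rewrite divr_ge0 ?mulr_ge0 ?(ltW s0) ?(ltW s2).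
rewrite -EFinM lee_fin -normal_peak_sqrt// -/K /rho /x0.
rewrite le_eqVlt; apply/orP; left; apply/eqP; rewrite -mulr_natr.
have -> : s ^+ 2 - 1 = (s - 1) * (s + 1) by ring.
have s_1 : 0 < s - 1 by rewrite subr_gt0.
have s_2 : 0 < s + 1 by rewrite addr_gt0.
by field; rewrite (gt_eqF s0) (gt_eqF s_1) (gt_eqF s_2) (gt_eqF c0).
Qed.

Lemma normal_prob_root m sigma M N : sigma != 0 ->
  normal_prob m sigma [set x | (M != 0) && (x * M + N == 0)] = 0%E.
Proof.
move=> s0; have [->|M0] := eqVneq M 0.
  by rewrite (_ : [set _ | _] = set0) ?measure0//; apply/seteqP; split.
have -> : [set x | true && (x * M + N == 0)] = [set - N / M].
  apply/seteqP; split=> x /=; first by move=> /eqP h; apply: (mulIf M0); rewrite divfK//; lra.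
  by move=> ->; rewrite divfK// addNr.
have /null_content_dominatesP := @normal_prob_dominates R m sigma.
by apply=> //; exact: lebesgue_measure_set1.
Qed.

End gaussian_estimates.

(** * Random matrices with a prescribed set of random entries *)

Section random_matrices.
Context (d : measure_display) (T : measurableType d) (R : realType)
  (P : probability T R) (n : nat) (S : {set 'I_n * 'I_n})
  (A : 'I_n -> 'I_n -> {RV P >-> R}).
Implicit Types (K : {set 'I_n * 'I_n}) (B : 'M[R]_n) (g : 'M[R]_n -> R)
  (i j k l : 'I_n).
Hypothesis indA : independent_RVs S (fun ij => A ij.1 ij.2).

Definition randomized K B (w : T) : 'M[R]_n :=
  \matrix_(i, j) if (i, j) \in K then A i j w else B i j.

Lemma randomized_split K B i j w : (i, j) \in K ->
  randomized K B w =
  randomized (K :\ (i, j)) (B - B i j *: delta_mx i j) w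
  + A i j w *: delta_mx i j.
Proof.
move=> ijK; apply/matrixP => r c; rewrite !mxE !inE /= xpair_eqE.
have [/andP[/eqP -> /eqP ->]|] := boolP ((r == i) && (c == j)).
  by rewrite ijK /= !mulr1 subrr add0r.
by rewrite /= !mulr0 subr0 addr0.
Qed.

Lemma randomized_drop K B i j w :
  randomized (K :\ (i, j)) B w =
  randomized (K :\ (i, j)) (B - B i j *: delta_mx i j) w
  + B i j *: delta_mx i j.
Proof.
apply/matrixP => r c; rewrite !mxE !inE /= xpair_eqE.
have [/andP[/eqP -> /eqP ->]|] := boolP ((r == i) && (c == j)).
  by rewrite /= !mulr1 subrr add0r.
by rewrite /= !mulr0 subr0 addr0.
Qed.

Lemma measurable_randomized K B i j :
  measurable_fun setT (fun w => randomized K B w i j).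
Proof.
under eq_fun do rewrite mxE.
by case: (_ \in K); [exact: measurable_funPT|exact: measurable_cst].
Qed.

Lemma measurable_randomized_rest K B i j r c : K \subset S ->
  measurable_fun setT (fun w : sigma_of (fun ij => A ij.1 ij.2) (S :\ (i, j)) =>
    randomized (K :\ (i, j)) B w r c).
Proof.
move=> KS.
rewrite (_ : (fun w => _) = (fun w =>
    if (r, c) \in K :\ (i, j) then A r c w else B r c)); last first.
  by apply/funext => w; rewrite mxE.
case: (boolP (_ \in _)) => rcK; last exact: measurable_cst.
apply: (@measurable_sigma_of _ _ _ P _ (fun ij => A ij.1 ij.2) _ (r, c)).
by move: rcK; rewrite !inE => /andP[-> /(fintype.subsetP KS)].
Qed.

Lemma borel_slope g i j : borel_mx g -> borel_mx (entry_slope g i j).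
Proof.
move=> bg d' T' C mC; apply: measurable_funB; apply: bg => // r c.
by under eq_fun do rewrite mxE; exact: measurable_funD.
Qed.

(** The randomized matrix with its entry (i, j) set to 0 depends on the other
    entries only.  Its values for g and for the slope of g are the constants N
    and M of the affine function x |-> x M + N that g is in that entry. *)
Definition slice_event K B g i j (Z : R -> R -> set R) : set T :=
  let C := randomized (K :\ (i, j)) (B - B i j *: delta_mx i j) in
  [set w | Z (entry_slope g i j (C w)) (g (C w)) (A i j w)].

(** Conditioning on the other entries: it suffices to bound the probability for
    fixed values of the slope M and of the constant term N. *)
Lemma slice_event_le K B g i j (Z : R -> R -> R -> bool) (c : \bar R) :
  borel_mx g -> K \subset S -> (i, j) \in K ->
  (forall d' (T' : measurableType d') (f1 f2 f3 : T' -> R),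
    measurable_fun setT f1 -> measurable_fun setT f2 -> measurable_fun setT f3 ->
    measurable_fun setT (fun w => Z (f1 w) (f2 w) (f3 w))) ->
  (forall M N, distribution P (A i j) [set x | Z M N x] <= c)%E ->
  (P (slice_event K B g i j Z) <= c)%E.
Proof.
move=> bg KS ijK mZ hZ.
pose X ij := A ij.1 ij.2.
pose C := randomized (K :\ (i, j)) (B - B i j *: delta_mx i j).
pose E : set (sigma_of X (S :\ (i, j)) * R) :=
  [set wx | Z (entry_slope g i j (C wx.1)) (g (C wx.1)) wx.2].
apply: (@prob_section_le _ _ _ P _ X S (i, j) E).
- exact: indA.
- exact: (fintype.subsetP KS).
- have mC : forall r c, measurable_fun setT
      (fun w : sigma_of X (S :\ (i, j)) => C w r c).
    by move=> r c'; exact: measurable_randomized_rest.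
  have mslope := borel_slope i j bg mC; have mg := bg _ _ _ mC.
  apply: measurable_event; apply: mZ; last exact: measurable_snd.
    by have := measurableT_comp mslope measurable_fst; exact.
  by have := measurableT_comp mg measurable_fst; exact.
- by move=> w; exact: (hZ (entry_slope g i j (C w)) (g (C w))).
Qed.

Variables (Abar : 'M[R]_n) (sigma : R).
Hypothesis sigma_gt0 : 0 < sigma.
Hypothesis lawA : forall i j, (i, j) \in S -> forall B : set R, measurable B ->
  distribution P (A i j) B = normal_prob (Abar i j) sigma B.

(** The ratio |a_ij D_ij g| / |g| of the random matrix is |x M| / |x M + N|. *)
Lemma entry_term_prob_le g i j (s : R) : entry_affine g -> borel_mx g ->
  (i, j) \in S -> `|Abar i j| <= 1 -> 1 < s ->
  (P [set w | (s * `|g (randomized S 0 w)| <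
               entry_term g (randomized S 0 w) (i, j))%R] <=
   ((1 + sigma) / sigma * Num.sqrt (2 / pi) / (s - 1))%:E)%E.
Proof.
move=> ag bg ijS a1 s1.
have -> : [set w | s * `|g (randomized S 0 w)| <
               entry_term g (randomized S 0 w) (i, j)] =
  slice_event S 0 g i j (fun M N x => s * `|x * M + N| < `|x * M|).
  apply/funext => w; rewrite /slice_event /entry_term /=.
  rewrite (randomized_split _ _ ijS) ag (entry_slope_shift _ _ _ _ ag).
  by rewrite !mxE !inE !eqxx /= mul0r subr0 !add0r mulr1 [g _ + _]addrC.
apply: slice_event_le => //.
- by move=> d' T' f1 f2 f3 m1 m2 m3; exact: measurable_affine_ratio_fun.
- move=> M N; rewrite lawA//; last exact: measurable_affine_ratio.
  exact: normal_prob_affine_ratio_le.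
Qed.

(** By induction on the number of randomized entries.  Before the last entry x is
    randomized, g is almost surely nonzero, so x M + N is not the zero
    polynomial in x.  After that g can only vanish when x hits the single root
    of this polynomial, an event of probability 0. *)
Lemma randomized_neq0 K B g : entry_affine g -> borel_mx g -> g B != 0 ->
  K \subset S -> P [set w | g (randomized K B w) = 0] = 0%E.
Proof.
move=> ag bg gB; move: {2}#|K| (erefl #|K|) => m.
elim: m K => [|m IH] K.
  move=> /eqP; rewrite cards_eq0 => /eqP -> _.
  rewrite (_ : [set _ | _] = set0) ?measure0//.
  apply/seteqP; split => // w /=.
  rewrite (_ : randomized _ _ _ = B); first by move/eqP; rewrite (negbTE gB).
  by apply/matrixP => i j; rewrite mxE inE.
move=> Km KS.
have [[i j] ijK] : exists ij, ij \in K.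
  by apply/set0Pn; rewrite -cards_eq0 Km.
have K'm : #|K :\ (i, j)| = m.
  by move: Km; rewrite (cardsD1 (i, j)) ijK add1n => -[].
have K'S : K :\ (i, j) \subset S by exact: fintype.subset_trans (subD1set _ _) KS.
have mg K' : measurable [set w | g (randomized K' B w) = 0].
  by apply: measurable_eq0; apply: bg => r c; exact: measurable_randomized.
pose Z (M N x : R) : bool := (M != 0) && (x * M + N == 0).
have mZ d' (T' : measurableType d') (f1 f2 f3 : T' -> R) :
    measurable_fun setT f1 -> measurable_fun setT f2 -> measurable_fun setT f3 ->
    measurable_fun setT (fun w => Z (f1 w) (f2 w) (f3 w)).
  move=> m1 m2 m3; apply: measurable_and.
    by apply: measurable_neg; exact: measurable_fun_eqr.
  apply: measurable_fun_eqr => //.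
  by apply: measurable_funD => //; exact: measurable_funM.
have : (P (slice_event K B g i j Z) <= 0)%E.
  apply: slice_event_le => // M N; rewrite lawA.
  - by rewrite normal_prob_root// gt_eqF.
  - exact: (fintype.subsetP KS).
  - have mMN := mZ _ _ (cst M) (cst N) (@idfun R)
      (measurable_cst _) (measurable_cst _) (@measurable_id _ _ _).
    exact: measurable_event mMN.
rewrite measure_le0 => /eqP PZ.
have mSlice : measurable (slice_event K B g i j Z).
  have mC r c := @measurable_randomized (K :\ (i, j)) (B - B i j *: delta_mx i j) r c.
  apply: measurable_event.
  exact: mZ (borel_slope i j bg mC) (bg _ _ _ mC) (measurable_funPT (A i j)).
apply/eqP; rewrite -measure_le0.
apply: (@le_trans _ _ (P ([set w | g (randomized (K :\ (i, j)) B w) = 0] `|`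
   slice_event K B g i j Z))).
  apply: le_measure; rewrite ?inE//; first exact: measurableU.
  move=> w /=; rewrite (randomized_split _ _ ijK) ag => g0.
  rewrite randomized_drop ag /slice_event /= /Z.
  have [M0|M0] := eqVneq; last by right; rewrite /= addrC; apply/eqP.
  by left; move: g0; rewrite M0 !mulr0.
apply: (le_trans (measureU2 _ _ _)) => //.
have P' := IH _ K'm K'S.
by rewrite -[leRHS]adde0; apply: leeD; [rewrite [leLHS]P'|rewrite [leLHS]PZ].
Qed.

End random_matrices.

(** * The tail of the condition number *)

Section tail_bound.
Context (d : measure_display) (T : measurableType d) (R : realType)
  (P : probability T R) (n : nat) (S : {set 'I_n * 'I_n})
  (Abar : 'M[R]_n) (sigma : R) (A : 'I_n -> 'I_n -> {RV P >-> R}).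
Hypothesis sigma_gt0 : 0 < sigma.
Hypothesis Agauss : gaussian_on S Abar sigma A.

Lemma prob_bigsetU_le (I : finType) (Q : pred I) (F : I -> set T)
    (c : I -> \bar R) :
  (forall i, Q i -> measurable (F i) /\ (P (F i) <= c i)%E) ->
  measurable (\big[setU/set0]_(i | Q i) F i) /\
  (P (\big[setU/set0]_(i | Q i) F i) <= \sum_(i | Q i) c i)%E.
Proof.
move=> h; elim/big_rec2: _ => [|i x B Qi [mB PB]].
  by split; [exact: measurable0|rewrite measure0].
have [mF PF] := h i Qi; split; first exact: measurableU.
by apply: (le_trans (measureU2 _ _ _)) => //; apply: leeD.
Qed.

Lemma le_prob_ae (E U : set T) : measurable E -> measurable U ->
  {ae P, forall w, E w -> U w} -> (P E <= P U)%E.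
Proof.
move=> mE mU [N [mN PN0 hN]].
apply: (@le_trans _ _ (P (U `|` N))).
  apply: le_measure; rewrite ?inE//; first exact: measurableU.
  move=> w Ew; apply: contrapT => /not_orP[nU]; apply; apply: hN => /= h.
  exact/nU/h.
by apply: (le_trans (measureU2 _ _ _)) => //; rewrite [X in (_ + X)%E]PN0 adde0.
Qed.

Lemma rmatrix_ae : {ae P, forall w, rmatrix A w = randomized A S 0 w}.
Proof.
have [_ _ A0] := Agauss.
have : {ae P, forall w, forall ij : 'I_n * 'I_n,
    ij \notin S -> A ij.1 ij.2 w = 0}.
  apply: filter_forall => -[i j] /=.
  by case: (boolP ((i, j) \in S)) => ijS; [exact/aeW|
    have := A0 i j ijS; apply: filterS].
apply: filterS => w h; apply/matrixP => i j; rewrite !mxE.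
by case: ifPn => // /h.
Qed.

(** A fixed matrix supported on S is entirely overwritten by randomizing the
    entries in S. *)
Lemma randomized_supported (B : 'M[R]_n) w : supported_mx S B ->
  randomized A S B w = randomized A S 0 w.
Proof.
by move=> SB; apply/matrixP => i j; rewrite !mxE; case: ifPn => // /SB.
Qed.

Lemma randomized_ae_neq0 (g : 'M[R]_n -> R) (B : 'M[R]_n) :
  entry_affine g -> borel_mx g -> supported_mx S B -> g B != 0 ->
  {ae P, forall w, g (randomized A S 0 w) != 0}.
Proof.
move=> ag bg SB gB; have [indA lawA _] := Agauss.
exists [set w | g (randomized A S B w) = 0]; split.
- by apply: measurable_eq0; apply: bg => r c; exact: measurable_randomized.
- exact: (randomized_neq0 indA sigma_gt0 lawA).
- by move=> w /= /negP; rewrite negbK -(randomized_supported _ SB) => /eqP.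
Qed.

(** The exceptional set of the closed form: a cofactor may be 0 only for the
    structural reason that it vanishes on the whole pattern S. *)
Lemma cofactors_ae : {ae P, forall w, forall k l : 'I_n,
  cofactor (randomized A S 0 w) l k != 0 \/ @cofactor_vanishes R n S l k}.
Proof.
have : {ae P, forall w, forall kl : 'I_n * 'I_n,
  cofactor (randomized A S 0 w) kl.2 kl.1 != 0 \/
  @cofactor_vanishes R n S kl.2 kl.1}.
  apply: filter_forall => -[k l] /=.
  have [van|nvan] := pselect (@cofactor_vanishes R n S l k).
    by apply/aeW => w; right.
  have [B [SB gB]] : exists B : 'M[R]_n, supported_mx S B /\ cofactor B l k <> 0.
    by move/existsNP: nvan => [y /not_implyP [? ?]]; exists y.
  have cB := @randomized_ae_neq0 (fun a => cofactor a l k) B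
    (@cofactor_entry_affine R n l k) (@borel_cofactor R n l k) SB (introN eqP gB).
  by apply: filterS cB => w ?; left.
by apply: filterS => w h k l; exact: (h (k, l)).
Qed.

Hypotheses (n_ge1 : (1 <= n)%N) (admS : admissible R S)
  (Abar_le1 : mx_norm Abar <= 1).

Lemma admissible_gt0 : (0 < #|S|)%N.
Proof.
have [B [SB uB]] := admS; have [i [j Bij]] := unitmx_neq0 (Ordinal n_ge1) uB.
by apply/card_gt0P; exists (i, j); apply: contraNT Bij => /SB ->.
Qed.

Lemma measurable_cinv_rmatrix :
  measurable_fun setT (fun w => cinv S (rmatrix A w)).
Proof.
by apply: measurable_cinv => i j; under eq_fun do rewrite mxE;
  exact: measurable_funPT.
Qed.

(** The union bound.  The events indexed by (k, l) and (i, j) in S are those of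
    [cinv_gt], each of probability at most b. *)
Lemma cinv_tail_le (t : R) : 2 * #|S|%:R < t ->
  (P [set w | (t%:E < cinv S (rmatrix A w))%E] <=
   ((1 + sigma) / sigma
    * (4 * n%:R ^+ 2 * #|S|%:R ^+ 2 / (t - 2 * #|S|%:R))
    * Num.sqrt (2 / pi))%:E)%E.
Proof.
move=> tS; have S0 := admissible_gt0.
have S0' : 0 < #|S|%:R :> R by rewrite ltr0n.
pose s := t / (2 * #|S|%:R).
have s1 : 1 < s by rewrite ltr_pdivlMr ?mulr_gt0// mul1r.
have t0 : 0 < t by apply: lt_trans tS; rewrite mulr_gt0.
pose U := randomized A S 0.
pose E g ij := [set w | s * `|g (U w)| < entry_term g (U w) ij].
have [indA lawA _] := Agauss.
set b := (1 + sigma) / sigma * Num.sqrt (2 / pi) / (s - 1).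
have PE (g : 'M[R]_n -> R) ij : entry_affine g -> borel_mx g -> ij \in S ->
    measurable (E g ij) /\ (P (E g ij) <= b%:E)%E.
  case: ij => i j ag bg ijS; split.
    have mU r c := @measurable_randomized _ _ _ _ _ A S 0 r c.
    apply: measurable_event; apply: measurable_fun_ltr.
      apply: measurable_funM => //.
      by apply: (measurableT_comp (@normr_measurable R setT)); exact: bg.
    apply: (measurableT_comp (@normr_measurable R setT)).
    apply: measurable_funM; first exact: mU.
    exact: (borel_slope i j bg mU).
  apply: (entry_term_prob_le indA sigma_gt0 lawA) => //.
  exact: le_trans (normr_entry_le _ _ _) Abar_le1.
pose F k l ij := E determinant ij `|` E (fun x => cofactor x l k) ij.
have PF k l ij : ij \in S -> measurable (F k l ij) /\
    (P (F k l ij) <= (b + b)%:E)%E.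
  move=> ijS.
  have [m1 p1] := PE _ _ (@det_entry_affine R n) (@borel_det R n) ijS.
  have [m2 p2] := PE _ _ (@cofactor_entry_affine R n l k)
    (@borel_cofactor R n l k) ijS.
  split; first exact: measurableU.
  by apply: (le_trans (measureU2 _ _ _)) => //; rewrite EFinD; exact: leeD.
pose V := \big[setU/set0]_(k < n) \big[setU/set0]_(l < n)
  \big[setU/set0]_(ij in S) F k l ij.
have [mV PV] : measurable V /\
    (P V <= \sum_(k < n) \sum_(l < n) \sum_(ij in S) (b + b)%:E)%E.
  apply: prob_bigsetU_le => k _; apply: prob_bigsetU_le => l _.
  by apply: prob_bigsetU_le => ij; exact: PF.
apply: (@le_trans _ _ (P V)).
  apply: le_prob_ae => //.
    have := emeasurable_fun_o_infty measurableT measurable_cinv_rmatrix t%:E.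
    by rewrite setTI.
  have [B [SB uB]] := admS.
  have detB : \det B != 0 by rewrite -unitfE -unitmxE.
  have := randomized_ae_neq0 (@det_entry_affine R n) (@borel_det R n) SB detB.
  apply: filterS3 rmatrix_ae cofactors_ae => w rw cof detU /=; rewrite rw => tc.
  have DU : inv_dom S (U w).
    split; last by apply/negP/negPn; rewrite unitmxE unitfE.
    by move=> i j ij; rewrite !mxE (negbTE ij).
  have [k [l [ij [ijS h]]]] := cinv_gt DU t0 S0 cof tc.
  rewrite /V (bigD1 k)//=; left; rewrite (bigD1 l)//=; left.
  by rewrite (bigD1 ij)//=; left.
apply: (le_trans PV); under eq_bigr do under eq_bigr do rewrite sumEFin.
under eq_bigr do rewrite sumEFin.
rewrite sumEFin lee_fin !sumr_const !card_ord -!mulrnA -[leLHS]mulr_natr.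
rewrite /b /s !natrM le_eqVlt; apply/orP; left; apply/eqP.
have ts : t - 2 * #|S|%:R != 0 by rewrite subr_eq0 gt_eqF.
move: (Num.sqrt (2 / pi)) => q; field.
by rewrite ts !gt_eqF.
Qed.

End tail_bound.

(** * Numerical constants *)

Section numeric_constants.
Variable R : realType.

Lemma sin_le (x : R) : 0 <= x -> sin x <= x.
Proof.
rewrite le_eqVlt => /predU1P[<-|x0]; first by rewrite sin0.
have [c _] := @MVT R sin cos 0 x x0 (fun y _ => is_derive_sin y)
  (continuous_subspaceT (@continuous_sin R)).
rewrite sin0 !subr0 => ->; rewrite ler_piMl ?(ltW x0)//; exact: cos_le1.
Qed.

(** The triple angle formula gives sin (pi / 6) = 1 / 2, and sin x <= x. *)
Lemma pi_ge3 : 3 <= pi :> R.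
Proof.
pose u : R := pi / 6.
have p0 := @pi_gt0 R.
have u0 : 0 < u by rewrite divr_gt0.
have u1 : u < pi / 2 by rewrite /u; lra.
have s0 : 0 < sin u by apply: sin_gt0_pihalf; rewrite u0.
have c0 : 0 < cos u by apply: cos_gt0_pihalf; rewrite u1 andbT; lra.
have : cos (u *+ 2 + u) = 0.
  rewrite (_ : u *+ 2 + u = pi / 2) ?cos_pihalf//.
  by rewrite /u -mulr_natr; lra.
rewrite cosD cos_mulr2n sin_mulr2n cos2sin2 => h.
have : cos u * (1 - 4 * sin u ^+ 2) = 0.
  by rewrite -[RHS]h; ring.
move=> /eqP; rewrite mulf_eq0 gt_eqF//= subr_eq0 => /eqP h2.
have s12 : sin u = 1 / 2.
  have : (sin u - 1 / 2) * (sin u + 1 / 2) = (4 * sin u ^+ 2 - 1) / 4 by field.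
  rewrite -h2 subrr mul0r.
  move=> /eqP; rewrite mulf_eq0 subr_eq0 [X in _ || X]gt_eqF ?orbF; last first.
    by rewrite addr_gt0.
  by move=> /eqP.
by have := sin_le (ltW u0); rewrite s12 /u; lra.
Qed.

Lemma sqrt_2_pi_le : Num.sqrt (2 / pi) <= 82 / 100 :> R.
Proof.
rewrite -[leRHS]ger0_norm; last by lra.
rewrite -sqrtr_sqr ler_wsqrtr// ler_pdivrMr ?pi_gt0//.
by have := pi_ge3; rewrite expr2; lra.
Qed.

(** Six squarings of exp x >= 1 + x at x = 1.83 / 64. *)
Lemma ln6_le : ln 6 <= 183 / 100 :> R.
Proof.
rewrite -[leRHS]expRK ler_ln ?posrE ?expR_gt0//.
pose x : R := 183 / 100 / 64.
have -> : 183 / 100 = x * 64%:R by rewrite /x; lra.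
rewrite expRM_natr.
pose y : R := 1 + x.
have yx : y ^+ 64 <= expR x ^+ 64.
  by rewrite lerXn2r ?nnegrE ?expR_ge0 ?expR_ge1Dx// /y /x; lra.
apply: le_trans yx.
have sq (u v : R) m : 0 <= u -> v <= u ^+ 2 -> u <= y ^+ m -> v <= y ^+ (m * 2).
  by move=> u0 vu uy; rewrite exprM (le_trans vu)// lerXn2r ?nnegrE// (le_trans u0).
have h1 : 1058 / 1000 <= y ^+ 2 by rewrite /y /x expr2; lra.
have h2 : 1119 / 1000 <= y ^+ 4 by apply: sq h1; rewrite ?expr2; lra.
have h3 : 1252 / 1000 <= y ^+ 8 by apply: sq h2; rewrite ?expr2; lra.
have h4 : 1567 / 1000 <= y ^+ 16 by apply: sq h3; rewrite ?expr2; lra.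
have h5 : 2455 / 1000 <= y ^+ 32 by apply: sq h4; rewrite ?expr2; lra.
by apply: sq h5; rewrite ?expr2; lra.
Qed.

Lemma integral_exp_tail (b K : R) : 0 <= K ->
  (\int[lebesgue_measure]_(r in `[b, +oo[) (K * expR (- r))%:E =
   (K * expR (- b))%:E)%E.
Proof.
move=> K0.
have dF (x : R) : is_derive x 1 (fun x => - (K * expR (- x))) (K * expR (- x)).
  apply: trigger_derive. by rewrite /GRing.scale/=; ring.
rewrite (@ge0_continuous_FTC2y _ _ (fun x => - (K * expR (- x))) _ 0)//.
- by rewrite sub0e -EFinN opprK.
- by move=> x _; rewrite mulr_ge0// expR_ge0.
- apply: continuous_subspaceT => x.
  apply: cvgM; first exact: cvg_cst.
  by apply: continuous_comp; [exact: opp_continuous|exact: continuous_expR].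
- rewrite -oppr0; apply: cvgN; rewrite -(mulr0 K); apply: cvgMr.
  exact: cvgr_expR.
- apply: cvg_at_right_filter; apply: cvgN; apply: cvgM; first exact: cvg_cst.
  by apply: continuous_comp; [exact: opp_continuous|exact: continuous_expR].
- by move=> x _; rewrite derive1E; exact: derive_val.
Qed.

End numeric_constants.

(** * From the tail to the expectation of the logarithm *)

Section log_expectation.
Context (d : measure_display) (T : measurableType d) (R : realType)
  (P : probability T R) (c : T -> \bar R) (kappa a q : R).
Hypotheses (mc : measurable_fun setT c) (kappa_ge1 : 1 <= kappa)
  (a_le : a <= 2 * kappa) (q_ge0 : 0 <= q).
Hypothesis tail : forall t, a < t ->
  (P [set w | (t%:E < c w)%E] <= (4 * kappa * q / (t - a))%:E)%E.

Let measurable_gt (t : R) : measurable [set w | (t%:E < c w)%E].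
Proof.
by have := emeasurable_fun_o_infty measurableT mc t%:E; rewrite setTI.
Qed.

Lemma tail_fin_ae : {ae P, forall w, c w != +oo%E}.
Proof.
have mN : measurable [set w | c w = +oo%E].
  have := measurable_fun_eqe mc (measurable_cst +oo%E).
  move=> /(_ measurableT [set true] I); rewrite setTI; congr measurable.
  by apply/seteqP; split=> w /= /eqP.
exists [set w | c w = +oo%E]; split=> //; last first.
  by move=> w /= /negP; rewrite negbK => /eqP.
apply/eqP; rewrite -measure_le0; apply/lee_addgt0Pr => e e0; rewrite add0e.
pose t := a + (4 * kappa * q + 1) / e.
have k0 : 0 <= 4 * kappa * q by rewrite !mulr_ge0// (le_trans _ kappa_ge1).
have t0 : 0 < (4 * kappa * q + 1) / e by rewrite divr_gt0// ltr_wpDl.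
apply: (@le_trans _ _ (P [set w | (t%:E < c w)%E])).
  by apply: le_measure; rewrite ?inE// => w /= ->; exact: ltry.
apply: le_trans (tail _) _; first by rewrite /t ltrDl.
rewrite lee_fin /t addrAC subrr add0r invf_div mulrA ler_pdivrMr ?ltr_wpDl//.
by rewrite mulrC ler_wpM2l ?(ltW e0)// lerDl.
Qed.

(** A real random variable that agrees with the positive part of lne c wherever
    c is finite; fine sends infinite values to 0, so the result there is 0. *)
Definition capped_ln (w : T) : R := ln (Num.max (fine (c w)) 1).

Lemma measurable_capped_ln : measurable_fun setT capped_ln.
Proof.
apply: (measurableT_comp (@measurable_ln R)); apply: measurable_maxr => //.
exact: (measurableT_comp (@fine_measurable R setT measurableT)).
Qed.

Lemma capped_ln_ge0 w : 0 <= capped_ln w.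
Proof. by apply: ln_ge0; rewrite le_max lexx orbT. Qed.

Lemma lne_pos w :
  maxe (lne (c w)) 0%E = if c w == +oo%E then +oo%E else (capped_ln w)%:E.
Proof.
rewrite /capped_ln; case: (c w) => [r| |] //=; last first.
  by rewrite (max_r (leNye _)) (max_r ler01) ln1.
have [r0|r0] := leP r 0.
  by rewrite (max_r (leNye _)) (max_r (le_trans r0 ler01)) ln1.
have [r1|r1] := leP r 1.
  by rewrite ln1 max_r// lee_fin ln_le0.
by rewrite max_l// lee_fin ln_ge0// ltW.
Qed.

Lemma measurable_lne_pos : measurable_fun setT (fun w => maxe (lne (c w)) 0%E).
Proof.
under eq_fun do rewrite lne_pos; apply: measurable_fun_ifT => //.
  exact: measurable_fun_eqe.
by apply/measurable_EFinP; exact: measurable_capped_ln.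
Qed.

Lemma capped_ln_gt (r : R) : 0 <= r ->
  [set w | r < capped_ln w] `<=` [set w | ((expR r)%:E < c w)%E].
Proof.
move=> r0 w; rewrite /capped_ln /=.
case: (c w) => [x| |] /=; rewrite ?ltry//.
- rewrite lte_fin => h.
  have : expR r < Num.max x 1.
    by rewrite -[ltRHS]lnK ?ltr_expR// posrE lt_max ltr01 orbT.
  rewrite lt_max => /orP[//|e1].
  by move: e1; rewrite -expR0 ltr_expR ltNge r0.
- by rewrite max_r ?ler01// ln1 ltNge r0.
Qed.

(** The expectation is the integral over r >= 0 of P (c > exp r).  Up to
    y0 = ln (6 kappa) the probability is bounded by 1.  Beyond it
    exp r >= 6 kappa >= 3 a, so exp r - a >= 2/3 exp r and the tail hypothesis
    gives 6 kappa q exp (- r), whose integral from y0 on is q. *)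
Lemma expectation_lne_le :
  (\int[P]_w maxe (lne (c w)) 0 <= (ln (6 * kappa) + q)%:E)%E.
Proof.
have k0 : 0 < kappa by exact: lt_le_trans kappa_ge1.
have mX := measurable_capped_ln.
pose X : {RV P >-> R} := mfun_Sub (mem_set mX).
have -> : (\int[P]_w maxe (lne (c w)) 0 = 'E_P[X])%E.
  rewrite expectation_def; apply: ge0_ae_eq_integral => //.
  - exact: measurable_lne_pos.
  - exact/measurable_EFinP.
  - by move=> w _; rewrite le_max lexx orbT.
  - by move=> w _; rewrite lee_fin capped_ln_ge0.
  - by apply: filterS tail_fin_ae => w /negbTE cw _; rewrite lne_pos cw.
rewrite ge0_expectation_ccdf; last exact: capped_ln_ge0.
have mccdf (D : set R) : measurable_fun D (ccdf X).
  exact: measurable_funS measurableT (@subsetT _ D) (ccdf_measurable X).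
have ccdf_le r : 0 <= r -> (ccdf X r <= P [set w | ((expR r)%:E < c w)%E])%E.
  move=> r0; rewrite /ccdf /distribution /pushforward.
  apply: le_measure; rewrite ?inE//.
    by rewrite -[_ @^-1` _]setTI; exact: measurable_funPT.
  by move=> w /=; rewrite in_itv /= andbT; exact: capped_ln_gt.
pose y0 := ln (6 * kappa).
have ey0 : expR y0 = 6 * kappa by rewrite lnK// posrE mulr_gt0.
have y00 : 0 <= y0.
  by apply: ln_ge0; move: kappa_ge1; lra.
have -> : `[0, +oo[%classic = `[0, y0[%classic `|` `[y0, +oo[%classic :> set R.
  apply/seteqP; split=> x /=; rewrite !in_itv /= !andbT.
    by move=> x0; case: (ltP x y0) => h; [left; rewrite x0|right].
  by move=> [/andP[]//|]; exact: le_trans.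
have disj : [disjoint `[0, y0[%classic & (`[y0, +oo[%classic : set R)].
  apply/disj_setPS => x [] /=; rewrite !in_itv/= andbT => /andP[_ h1] h2.
  by move: h1; rewrite ltNge h2.
have mU := mccdf (`[0, y0[%classic `|` `[y0, +oo[%classic).
rewrite ge0_integral_setU//.
rewrite EFinD; apply: leeD.
  apply: (@le_trans _ _ (\int[lebesgue_measure]_(x in `[0%R, y0[) (cst 1%E x))%E).
    apply: ge0_le_integral => //; first exact: mccdf.
    by move=> x _; exact: probability_le1.
  rewrite integral_cst//= mul1e lebesgue_measure_itv /= lte_fin.
  by case: ifP => _; rewrite ?oppr0 ?adde0 ?lee_fin// -EFinB subr0.
apply: (@le_trans _ _ (\int[lebesgue_measure]_(r in `[y0, +oo[)
    (6 * kappa * q * expR (- r))%:E)%E); last first.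
  rewrite integral_exp_tail ?mulr_ge0 ?(ltW k0)// lee_fin expRN ey0.
  by rewrite le_eqVlt; apply/orP; left; apply/eqP; field; rewrite gt_eqF.
apply: ge0_le_integral => //; first exact: mccdf.
  apply/measurable_EFinP; apply: measurable_funM => //.
  by apply: measurable_funTS; apply: (measurableT_comp (@measurable_expR R)).
move=> r /=; rewrite in_itv /= andbT => y0r.
have r0 : 0 <= r by exact: le_trans y0r.
have er : 6 * kappa <= expR r by rewrite -ey0 ler_expR.
have ra : a < expR r by move: a_le er k0; lra.
apply: (le_trans (ccdf_le r r0)); apply: (le_trans (tail ra)).
rewrite lee_fin ler_pdivrMr ?subr_gt0// expRN.
have e0 := expR_gt0 r.
have h : expR r <= 3 / 2 * (expR r - a) by move: a_le er; lra.
rewrite -mulrA mulrAC -[leRHS]mulrA.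
have kq : 0 <= kappa * q by rewrite mulr_ge0// ltW.
rewrite [leRHS](_ : _ = (kappa * q) * (6 * ((expR r - a) / expR r))); last first.
  by field; rewrite gt_eqF.
rewrite [leLHS](_ : _ = (kappa * q) * 4); last by ring.
rewrite ler_wpM2l// mulrA ler_pdivlMr//; lra.
Qed.

End log_expectation.

Lemma integral_le_pos (d : measure_display) (T : measurableType d)
    (R : realType) (mu : {measure set T -> \bar R}) (f : T -> \bar R) :
  (\int[mu]_w f w <= \int[mu]_w maxe (f w) 0)%E.
Proof.
rewrite integralE; under [leRHS]eq_integral do rewrite -funeposE.
by rewrite geeDl// oppe_le0; exact: integral_ge0.
Qed.

(** * Smoothed analysis of matrix inversion *)

Theorem theorem3 (R : realType) (d : measure_display) (T : measurableType d)
    (P : probability T R) (n : nat) (S : {set 'I_n * 'I_n}) (Abar : 'M[R]_n)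
    (sigma : R) (A : 'I_n -> 'I_n -> {RV P >-> R})
    (n_ge1 : (1 <= n)%N) (admS : admissible R S)
    (AbarS : supported_mx S Abar) (Abar_le1 : mx_norm Abar <= 1)
    (sigma_gt0 : 0 < sigma) (A_gauss : gaussian_on S Abar sigma A) :
  (forall t : R, 2 * #|S|%:R < t ->
     (P [set w | (t%:E < cinv S (rmatrix A w))%E] <=
      ((1 + sigma) / sigma
       * (4 * n%:R ^+ 2 * #|S|%:R ^+ 2 / (t - 2 * #|S|%:R))
       * Num.sqrt (2 / pi))%:E)%E) /\
  (forall beta : R, 1 < beta ->
     (\int[P]_w loge beta (cinv S (rmatrix A w)) <=
      (log beta ((1 + sigma) / sigma) + 2 * log beta (n%:R * #|S|%:R)
       + 265 / 100 / ln beta)%:E)%E).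
Proof.
have tailP := cinv_tail_le sigma_gt0 A_gauss n_ge1 admS Abar_le1.
split=> [//|beta beta1].
have S0 := admissible_gt0 n_ge1 admS.
have lnb0 : 0 < ln beta by rewrite ln_gt0.
(* In terms of kappa and q the tail bound reads 4 kappa q / (t - 2 |S|). *)
pose kappa : R := (1 + sigma) / sigma * (n%:R ^+ 2 * #|S|%:R ^+ 2).
pose q : R := Num.sqrt (2 / pi).
have q0 : 0 <= q by exact: sqrtr_ge0.
have n1 : 1 <= n%:R :> R by rewrite ler1n.
have S1 : 1 <= #|S|%:R :> R by rewrite ler1n.
have nS0 : 0 < n%:R * #|S|%:R :> R by rewrite mulr_gt0// (lt_le_trans ltr01).
have sg1 : 1 <= (1 + sigma) / sigma by rewrite ler_pdivlMr// mul1r lerDr.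
have kS : #|S|%:R <= kappa.
  rewrite /kappa -[leLHS]mul1r ler_pM// -[leLHS]mul1r ler_pM ?exprn_ege1//.
  by rewrite expr2 ler_peMl// (le_trans ler01).
have k1 : 1 <= kappa by exact: le_trans kS.
have a2 : 2 * #|S|%:R <= 2 * kappa by rewrite ler_pM2l.
have tailK t : 2 * #|S|%:R < t ->
    (P [set w | (t%:E < cinv S (rmatrix A w))%E] <=
     (4 * kappa * q / (t - 2 * #|S|%:R))%:E)%E.
  move=> ht; apply: le_trans (tailP t ht) _; rewrite lee_fin.
  by rewrite le_eqVlt; apply/orP; left; apply/eqP; rewrite /kappa /q; ring.
have mc := measurable_cinv_rmatrix S A.
have Eln := expectation_lne_le mc k1 a2 q0 tailK.
apply: le_trans (integral_le_pos _ _) _.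
have Vb : 0 <= (ln beta)^-1 by rewrite invr_ge0 ltW.
rewrite (_ : (fun w => _) = (fun w =>
    (ln beta)^-1%:E * maxe (lne (cinv S (rmatrix A w))) 0)%E); last first.
  by apply/funext => w; rewrite /loge muleC maxe_pMr// mule0.
rewrite ge0_integralZl_EFin//; last 2 first.
- by move=> w _; rewrite le_max lexx orbT.
- exact: measurable_lne_pos.
apply: (@le_trans _ _ ((ln beta)^-1%:E * (ln (6 * kappa) + q)%:E)%E).
  by rewrite lee_wpmul2l// lee_fin.
rewrite -EFinM lee_fin [leRHS](_ : _ = (ln beta)^-1 *
    (ln ((1 + sigma) / sigma) + 2 * ln (n%:R * #|S|%:R) + 265 / 100)); last first.
  by rewrite /log; ring.
rewrite ler_wpM2l//.
have -> : ln (6 * kappa) =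
    ln 6 + (ln ((1 + sigma) / sigma) + 2 * ln (n%:R * #|S|%:R)).
  rewrite /kappa lnM ?posrE ?(lt_le_trans ltr01 k1)//; congr (_ + _).
  rewrite lnM ?posrE ?(lt_le_trans ltr01 sg1)//; last by rewrite -exprMn exprn_gt0.
  by congr (_ + _); rewrite -exprMn lnXn// mulr_natl.
by have := sqrt_2_pi_le R; have := ln6_le R; rewrite -/q; lra.
Qed.
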